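(* Let $\lambda>0$, let $n\ge0$ be an integer, and let $\vartheta$ be a nontrivial even probability measure on $\mathbb{R}/\mathbb{Z}$. Let $\varphi_{n+1}(z)=\varphi_{n+1}(z;d\vartheta)$ be the $(n+1)$-th orthonormal polynomial on the unit circle with respect to this measure, with associated $K_n$, $A_{n+1}$, $B_{n+1}$. Let $\mathcal{A}_{n+1}=\{\xi\in\mathbb{R}/\mathbb{Z}:A_{n+1}(e^{2\pi i\xi})=0\}$ and $\mathcal{B}_{n+1}=\{\xi\in\mathbb{R}/\mathbb{Z}:B_{n+1}(e^{2\pi i\xi})=0\}$. (i) If $\ell\in\Lambda_n$ satisfies $\ell(\theta)\le f_\lambda(\theta)$ for all $\theta\in\mathbb{R}$, then $$\int_{\mathbb{R}/\mathbb{Z}}\ell(\theta)\,d\vartheta(\theta)\le\sum_{\xi\in\mathcal{A}_{n+1}}\frac{f_\lambda(\xi)}{K_n(e^{2\pi i\xi},e^{2\pi i\xi})}.$$ Moreover, there exists a unique trigonometric polynomial $\theta\mapsto\ell_\vartheta(n,\lambda,\theta)\in\Lambda_n$ with $\ell_\vartheta(n,\lambda,\theta)\le f_\lambda(\theta)$ for all $\theta\in\mathbb{R}$ for which equality holds in this integral inequality. (ii) If $m\in\Lambda_n$ satisfies $m(\theta)\ge f_\lambda(\theta)$ for all $\theta\in\mathbb{R}$, then $$\int_{\mathbb{R}/\mathbb{Z}}m(\theta)\,d\vartheta(\theta)\ge\sum_{\xi\in\mathcal{B}_{n+1}}\frac{f_\lambda(\xi)}{K_n(e^{2\pi i\xi},e^{2\pi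 i\xi})}.$$ Moreover, there exists a unique trigonometric polynomial $\theta\mapsto m_\vartheta(n,\lambda,\theta)\in\Lambda_n$ with $m_\vartheta(n,\lambda,\theta)\ge f_\lambda(\theta)$ for all $\theta\in\mathbb{R}$ for which equality holds in this integral inequality.
   Context: $f_\lambda(\theta)=\dfrac{\cosh(\lambda(\theta-\lfloor\theta\rfloor-\frac12))}{\sinh(\lambda/2)}=\sum_{j\in\mathbb{Z}}e^{-\lambda|\theta+j|}$, a $1$-periodic function. $\Lambda_n$ is the space of trigonometric polynomials $\sum_{k=-n}^na_ke^{2\pi ik\theta}$, $a_k\in\mathbb{C}$. A measure is nontrivial if it does not have finite support. Measures on $\mathbb{R}/\mathbb{Z}$ are identified with measures on the unit circle $\partial\mathbb{D}$ via $\theta\mapsto e^{2\pi i\theta}$; $\vartheta$ is even if the corresponding measure on $\partial\mathbb{D}$ satisfies $\vartheta(S)=\vartheta(\overline S)$ for all Borel sets $S\subset\partial\mathbb{D}$. The monic orthogonal polynomials $\Phi_m(z)=z^m+\text{lower order terms}$ are determined by $\int_{\partial\mathbb{D}}\Phi_m(z)\overline z^{\,j}d\vartheta(z)=0$ for $0\le j<m$; the orthonormal polynomials are $\varphi_m=\Phi_m/\|\Phi_m\|_{L^2(\partial\mathbb{D},d\vartheta)}$. For a polynomial $P$ of exact degree $m$, $P^*(z)=z^m\,\overline{P(\overline z^{\,-1})}$. Then $$K_n(w,z)=\frac{\varphi_{n+1}^*(z)\overline{\varphi_{n+1}^*(w)}-\varphi_{n+1}(z)\overline{\varphi_{n+1}(w)}}{1-\overline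 wz}$$ (extended by continuity to $\overline wz=1$) is the reproducing kernel of the polynomials of degree at most $n$ with the inner product of $L^2(\partial\mathbb{D},d\vartheta)$, and $$A_{n+1}=\tfrac12\{\varphi_{n+1}^*+\varphi_{n+1}\},\qquad B_{n+1}=\tfrac i2\{\varphi_{n+1}^*-\varphi_{n+1}\}.$$ *)

(* Defs.v *)
From mathcomp Require Import all_boot all_order all_algebra.
From mathcomp.real_closed Require Import complex.
From mathcomp Require Import all_classical all_reals all_analysis.
Import Order.TTheory GRing.Theory Num.Theory.
Import numFieldNormedType.Exports.
Set Implicit Arguments.
Unset Strict Implicit.
Unset Printing Implicit Defensive.
Local Open Scope classical_set_scope.
Local Open Scope ring_scope.

(* Functions on R/Z are 1-periodic functions on R, and a point of R/Z is its
   representative in [0, 1[.  A probability measure on R/Z is a Borel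
   probability measure [mu] on R carried by [0, 1[, i.e. [mu `[0, 1[ = 1]; the
   theorem assumes this, and integrals over R/Z are then integrals over R. *)

Definition cosh {R : realType} (x : R) : R := (expR x + expR (- x)) / 2.
Definition sinh {R : realType} (x : R) : R := (expR x - expR (- x)) / 2.

Definition flambda {R : realType} (lambda theta : R) : R :=
  cosh (lambda * (theta - (Num.floor theta)%:~R - 2^-1)) / sinh (lambda / 2).

(* e^{2 pi i theta} *)
Definition ecirc {R : realType} (theta : R) : R[i] :=
  (cos (2 * pi * theta) +i* sin (2 * pi * theta))%C.

(* Trigonometric polynomials of degree at most n; the summation index [k]
   stands for the frequency [k - n]. *)
Definition trig_poly {R : realType} (n : nat) : set (R -> R[i]) :=
  [set l | exists a : 'I_(n.*2.+1) -> R[i], forall theta : R,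
     l theta = \sum_(k < n.*2.+1) a k * ecirc ((k%:R - n%:R) * theta)].

Section CircleMeasure.
Context {R : realType}.
Variable mu : probability (measurableTypeR R) R.

(* The topological support of the image of [mu] on the unit circle (a point off
   the circle is never in it). *)
Definition circle_support : set R[i] :=
  [set z | forall eps : R, 0 < eps ->
     (0 < mu [set x | (ComplexField.Normc.normc (ecirc x - z) < eps)%R])%E].

Definition nontrivial_measure : Prop := ~ finite_set circle_support.

(* A subset of the unit circle is Borel iff its preimage under [ecirc] is a
   Borel subset of R; only the trace of [S] on the circle matters here. *)
Definition even_measure : Prop :=
  forall S : set R[i], measurable (ecirc @^-1` S : set (measurableTypeR R)) ->
    mu (ecirc @^-1` S) = mu (ecirc @^-1` [set z^* | z in S]).

Definition cintegral (f : R -> R[i]) : R[i] :=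
  ((\int[mu]_x complex.Re (f x)) +i* (\int[mu]_x complex.Im (f x)))%C.

(* P is the monic orthogonal polynomial Phi_m ([size] is 1 + degree). *)
Definition monic_orth (m : nat) (P : {poly R[i]}) : Prop :=
  [/\ size P = m.+1, P \is monic &
      forall j : nat, (j < m)%N ->
        cintegral (fun x => P.[ecirc x] * (ecirc x)^* ^+ j) = 0].

Definition Phi (m : nat) : {poly R[i]} := xget 0 [set P | monic_orth m P].

Definition normL2 (P : {poly R[i]}) : R :=
  Num.sqrt (\int[mu]_x (ComplexField.Normc.normc P.[ecirc x] ^+ 2)).

Definition phi (m : nat) : {poly R[i]} := ((normL2 (Phi m))^-1)%:C%C *: Phi m.

End CircleMeasure.

(* P^* for P of exact degree m = (size P).-1. Written on coefficients, so that
   it is a polynomial also at 0; see [recip_horner]. *)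
Definition recip {R : realType} (P : {poly R[i]}) : {poly R[i]} :=
  \poly_(i < size P) (P`_((size P).-1 - i))^*.

Lemma recip_horner {R : realType} (P : {poly R[i]}) (z : R[i]) : z != 0 ->
  (recip P).[z] = z ^+ (size P).-1 * (P.[(z^*)^-1])^*.
Proof.
move=> z0; rewrite horner_poly horner_coef rmorph_sum mulr_sumr.
rewrite (reindex_inj rev_ord_inj) /=; apply: eq_bigr => i _.
have lei : (i <= (size P).-1)%N by rewrite -ltnS (ltn_predK (ltn_ord i)).
have -> : (size P - i.+1 = (size P).-1 - i)%N by rewrite subnS -subn1 subnAC subn1.
rewrite subKn // rmorphM rmorphXn fmorphV /= conjCK mulrCA; congr (_ * _).
by rewrite exprVn expfB_cond // (negbTE z0).
Qed.

Section Kernel.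
Context {R : realType}.
Variables (mu : probability (measurableTypeR R) R) (n : nat).

Let p : {poly R[i]} := phi mu n.+1.

Definition kernel_quotient (w z : R[i]) : R[i] :=
  ((recip p).[z] * ((recip p).[w])^* - p.[z] * (p.[w])^*) / (1 - w^* * z).

(* Where conj(w) z = 1, the value is the limit in z; [R[i]^o] carries the
   topology of the complex norm. *)
Definition Kn (w z : R[i]) : R[i] :=
  if w^* * z == 1
  then lim ((kernel_quotient w : R[i]^o -> R[i]^o) @ (z : R[i]^o)^')
  else kernel_quotient w z.

(* The polynomials A_{n+1} and B_{n+1}. *)
Definition An : {poly R[i]} := 2^-1 *: (recip p + p).
Definition Bn : {poly R[i]} := ('i%C / 2) *: (recip p - p).

End Kernel.

(* The zeros of P on the unit circle, as points of R/Z. *)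
Definition circle_zeros {R : realType} (P : {poly R[i]}) : set R :=
  [set xi | 0 <= xi < 1 /\ P.[ecirc xi] = 0].

(* Main.v *)
Require Import Defs.
From mathcomp Require Import all_boot all_order all_algebra.
From mathcomp.real_closed Require Import complex.
From mathcomp Require Import all_classical all_reals all_analysis.
From mathcomp Require Import ring lra zify.
Import Order.TTheory GRing.Theory Num.Theory.
Import numFieldNormedType.Exports.
Local Open Scope classical_set_scope.
Local Open Scope ring_scope.
Set Implicit Arguments.
Unset Strict Implicit.
Unset Printing Implicit Defensive.

(** The quadrature side.  Let [p] be the orthonormal polynomial of degree [n+1],
    [p*] its reciprocal, and for [t = 1] or [t = -1] let [Y = p* + t p]; up to a
    constant [Y] is [A_{n+1}] or [B_{n+1}].  [Y] is orthogonal to [X, ..., X^n] and equal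
    to [t] times its reciprocal, which forces its [n+1] zeros to be simple and to lie on the
    unit circle ([paraorth_no_inverse_pair], [paraorth_roots]).  Dividing by [Y] and
    interpolating the remainder gives a quadrature formula at these zeros that is
    exact on trigonometric polynomials of degree at most [n] ([quadrature]); its
    weights are positive and equal to [1 / K_n(z, z)] ([quad_weight_gt0], [Kn_root]).
    The integral inequalities follow at once, and equality forces
    interpolation of [flambda] at all the zeros.

    Uniqueness.  Two one-sided trigonometric polynomials interpolating [flambda] at
    the zeros also have equal derivatives there, except perhaps at [theta = 0],
    where [flambda] has a corner: their difference has degree at most [n] and at
    least [2n+1] zeros, with multiplicity ([touching_unique]).

    Existence.  In the coordinate [u = (1 + cos (2 pi theta)) / 2] the function
    [flambda] is a power series in [u] with nonnegative coefficients, convergent on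
    all of [0 <= u <= 1] ([flambda_series]): [cosh (lambda t)] and the partial sums in
    [sin^2 (pi t)] differ by the solution of [E'' = lambda^2 E + rem] with [rem >= 0] and
    zero initial data.  As the measure is even, [p] has real coefficients, the
    zeros of [Y] are closed under conjugation, and the monic polynomial [W] whose roots
    are their [u]-coordinates satisfies [t W(u) = a |Y|^2] on the circle with [a > 0]
    ([node_poly_sign]).  Division of a polynomial with nonnegative coefficients by
    [W] yields a quotient with nonnegative coefficients, because the roots
    of [W] are nonnegative ([divp_prod_XsubC_nneg]).  Hence the difference between a
    partial sum and its remainder modulo [W] is [W] times a nonnegative function, so
    that its product by [t] is nonnegative on the circle.  The quadrature formula
    bounds the coefficients of the quotients, so the remainders converge
    ([interpolant_cvg]); the limit is the extremal function ([extremal_exists]).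
    No case distinction on the parity of [n] is needed. *)

Local Notation Re := complex.Re.
Local Notation Im := complex.Im.
Local Notation normc := ComplexField.Normc.normc.

(** * The hyperbolic cosine as a power series in sin^2 *)

Lemma ger0_is_derive_le (R : realType) (F F1 : R -> R) (b : R) :
  (forall t : R, is_derive t (1 : R) F (F1 t)) ->
  (forall t, 0 <= t <= b -> 0 <= F1 t) ->
  forall t, 0 <= t <= b -> F 0 <= F t.
Proof.
move=> dF F1ge0 t /andP[t0 tb].
apply: (@ger0_derive1_ndecr R F 0 b) => //.
- by move=> x; rewrite in_itv/= => /andP[x0 xb]; rewrite derive1E derive_val F1ge0 ?(ltW x0) ?ltW.
- apply: derivable_within_continuous => x _; exact: ex_derive.
Qed.

(** Comparison for [F'' - lambda^2 F = (D - lambda) (D + lambda) F]: each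
    first-order factor preserves nonnegativity when the initial data vanish. *)
Lemma second_order_comparison (R : realType) (lambda b : R) (F F1 F2 : R -> R) :
  (forall t : R, is_derive t (1 : R) F (F1 t)) -> (forall t : R, is_derive t (1 : R) F1 (F2 t)) ->
  F 0 = 0 -> F1 0 = 0 ->
  (forall t, 0 <= t <= b -> lambda ^+ 2 * F t <= F2 t) ->
  forall t, 0 <= t <= b -> 0 <= F t.
Proof.
move=> dF dF1 F0 F10 hF2.
have G0 : forall t, 0 <= t <= b -> 0 <= F1 t + lambda * F t.
  move=> t ht.
  have : 0 <= expR (- lambda * t) * (F1 t + lambda * F t).
    have := @ger0_is_derive_le R (fun t => expR (- lambda * t) * (F1 t + lambda * F t))
      (fun t => expR (- lambda * t) * (F2 t - lambda ^+ 2 * F t)) b _ _ t ht.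
    rewrite F0 F10 !mulr0 addr0 !mulr0; apply.
      move=> x; apply: is_derive_eq.
      by rewrite /GRing.scale/=; ring.
    by move=> x hx; rewrite mulr_ge0 ?expR_ge0// subr_ge0 hF2.
  by rewrite pmulr_rge0 // expR_gt0.
move=> t ht.
have : 0 <= expR (lambda * t) * F t.
  have := @ger0_is_derive_le R (fun t => expR (lambda * t) * F t)
      (fun t => expR (lambda * t) * (F1 t + lambda * F t)) b _ _ t ht.
  rewrite F0 !mulr0; apply.
    move=> x; apply: is_derive_eq.
    by rewrite /GRing.scale/=; ring.
  by move=> x hx; rewrite mulr_ge0 ?expR_ge0// G0.
by rewrite pmulr_rge0 // expR_gt0.
Qed.

Lemma is_derive_horner_sin2 (R : realType) (p : {poly R}) (t : R) :
  is_derive t (1 : R) (fun t => p.[sin (pi * t) ^+ 2])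
    (p^`().[sin (pi * t) ^+ 2] * (2 * pi * sin (pi * t) * cos (pi * t))).
Proof.
have h := @is_derive_poly R p (sin (pi * t) ^+ 2).
have h2 : is_derive t (1 : R) (fun t => sin (pi * t) ^+ 2) (2 * pi * sin (pi * t) * cos (pi * t)).
  by apply: is_derive_eq; rewrite /GRing.scale/=; ring.
have := @is_derive1_comp R (horner p) (fun t => sin (pi * t) ^+ 2) t _ _ h h2.
exact.
Qed.

Lemma is_derive_cosh (R : realType) (a t : R) :
  is_derive t (1 : R) (fun t => cosh (a * t)) (a * sinh (a * t)).
Proof.
by rewrite /cosh /sinh; apply: is_derive_eq; rewrite /GRing.scale/=; ring.
Qed.

Lemma is_derive_sinh (R : realType) (a t : R) :
  is_derive t (1 : R) (fun t => sinh (a * t)) (a * cosh (a * t)).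
Proof.
by rewrite /cosh /sinh; apply: is_derive_eq; rewrite /GRing.scale/=; ring.
Qed.

Lemma sinh_gt0 (R : realType) (x : R) : 0 < x -> 0 < sinh x.
Proof. by move=> x0; rewrite /sinh divr_gt0// subr_gt0 ltr_expR; lra. Qed.

(** Coefficients of [cosh (lambda t)] as a power series in [sin^2 (pi t)], where
    [a2 = (lambda / (2 pi))^2]. *)
Fixpoint cosh_coef (R : realType) (a2 : R) (k : nat) : R :=
  if k is j.+1 then
    (j%:R ^+ 2 + a2) / (j.+1%:R * (j%:R + 2^-1)) * cosh_coef a2 j
  else 1.

(** Partial sum of that series, with [N] terms. *)
Definition cosh_trunc (R : realType) (a2 : R) (N : nat) : {poly R} :=
  \sum_(k < N) cosh_coef a2 k *: 'X^k.

Lemma cosh_coef_ge0 (R : realType) (a2 : R) k : 0 <= a2 -> 0 <= cosh_coef a2 k.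
Proof.
move=> a0; elim: k => [|k ih] /=; first exact: ler01.
by rewrite mulr_ge0// divr_ge0// ?addr_ge0// ?mulr_ge0// ?addr_ge0// sqr_ge0.
Qed.

Lemma horner_cosh_trunc (R : realType) (a2 : R) N (u : R) :
  (cosh_trunc a2 N).[u] = \sum_(k < N) cosh_coef a2 k * u ^+ k.
Proof.
by rewrite horner_sum; apply: eq_bigr => k _; rewrite hornerZ hornerXn.
Qed.

(** The differential equation of [cosh (lambda t)], divided by [2 pi^2] and written in
    [u = sin^2 (pi t)], holds for the partial sums up to one monomial: the recurrence
    of the coefficients makes all other terms cancel. *)
Lemma cosh_trunc_ode (R : realType) (a2 : R) N (u : R) :
  let p := cosh_trunc a2 N.+1 in
  2 * u * (1 - u) * p^`()^`().[u] + (1 - 2 * u) * p^`().[u] =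
  2 * a2 * p.[u] - 2 * (N%:R ^+ 2 + a2) * cosh_coef a2 N * u ^+ N.
Proof.
rewrite /cosh_trunc; elim: N => [|N]; cbv zeta; last move=> ih.
  by rewrite big_ord1 expr0 alg_polyC !derivC !hornerE; ring.
have -> : \sum_(k < N.+2) cosh_coef a2 k *: 'X^k =
    \sum_(k < N.+1) cosh_coef a2 k *: 'X^k + cosh_coef a2 N.+1 *: 'X^(N.+1).
  by rewrite big_ord_recr.
move: ih; set q : {poly R} := \sum_(_ < _) _ => ih.
have hc : cosh_coef a2 N.+1 * (N.+1%:R * (2 * N%:R + 1)) = 2 * (N%:R ^+ 2 + a2) * cosh_coef a2 N.
  rewrite /=; have h1 : N.+1%:R != 0 :> R by rewrite pnatr_eq0.
  have h3 : N%:R * 2 + 1 != 0 :> R by rewrite gt_eqF// ltr_wpDl// mulr_ge0.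
  by field; rewrite h3 addrC natr1.
move: (cosh_coef a2 N.+1) (cosh_coef a2 N) hc ih => c' c hc ih.
rewrite !derivD !derivZ derivXn !derivMn derivXn !hornerE !hornerMn !hornerXn /=.
have e2 : N.+1%:R = N%:R + 1 :> R by rewrite -natr1.
have hN : u * (u ^+ N.-1 *+ N) = N%:R * u ^+ N.
  by case: (N) => [|k]; rewrite ?mulr0n ?mulr0 ?mul0r//= mulrnAr -exprS mulr_natl.
have -> : u ^+ N.+1 = u * u ^+ N by rewrite exprS.
transitivity ((2 * u * (1 - u) * q^`()^`().[u] + (1 - 2 * u) * q^`().[u]) +
   c' * (2 * (1 - u) * N.+1%:R * (u * (u ^+ N.-1 *+ N)) + (1 - 2 * u) * N.+1%:R * u ^+ N)).
  set v := u ^+ N.-1; set w := u ^+ N.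
  rewrite -(mulr_natl v) -(mulr_natl (_ * v)) -(mulr_natl w); ring.
rewrite ih hN.
have e1 : c' * (N.+1%:R * (2 * N%:R + 1)) * u ^+ N = 2 * (N%:R ^+ 2 + a2) * c * u ^+ N by rewrite hc.
apply/eqP; rewrite -subr_eq0; apply/eqP.
transitivity (c' * (N.+1%:R * (2 * N%:R + 1)) * u ^+ N - 2 * (N%:R ^+ 2 + a2) * c * u ^+ N).
  by rewrite e2; ring.
by rewrite e1 subrr.
Qed.

(** With [x = z^4], [N^2 x^N = (N z^N)^2 (z^2)^N], and [N z^N] is bounded. *)
Lemma sqr_expr_cvg0 (R : realType) (x : R) : 0 <= x < 1 ->
  (fun N : nat => N%:R ^+ 2 * x ^+ N) @ \oo --> (0 : R).
Proof.
move=> /andP[x0 x1].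
pose z := Num.sqrt (Num.sqrt x).
have z0 : 0 <= z by exact: sqrtr_ge0.
have zx : x = z ^+ 4 by rewrite (_ : 4 = 2 * 2)%N// exprM !sqr_sqrtr ?sqrtr_ge0.
have z1 : z < 1 by rewrite /z -sqrtr1 ltr_sqrt// -[ltRHS]sqrtr1 ltr_sqrt.
have hz : 0 < 1 - z by rewrite subr_gt0.
(* [N z^N <= 1 + z + ... + z^(N-1) <= 1 / (1 - z)]. *)
have nE N : N%:R * z ^+ N <= (1 - z)^-1.
  rewrite -div1r ler_pdivlMr//.
  have e1 : 1 = (1 - z) * (\sum_(i < N) z ^+ i) + z ^+ N.
    by rewrite -[1 - z]opprB mulNr -subrX1 opprB subrK.
  rewrite [leRHS]e1 -[leLHS]addr0 lerD ?exprn_ge0// mulrC ler_pM2l//.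
  rewrite mulr_natl -[X in _ *+ X]card_ord -sumr_const.
  by apply: ler_sum => i _; rewrite ler_wiXn2l ?(ltW z1)// ltnW.
have h0 : (fun N : nat => ((1 - z)^-1) ^+ 2 * (z ^+ 2) ^+ N) @ \oo --> (0 : R).
  rewrite -[0](mulr0 ((1 - z)^-1 ^+ 2)); apply: cvgMr; apply: cvg_expr.
  by rewrite ger0_norm ?sqr_ge0// expr_lt1.
apply: (squeeze_cvgr _ (cvg_cst 0) h0).
near=> N; apply/andP; split; first by rewrite mulr_ge0// ?sqr_ge0// exprn_ge0.
have -> : N%:R ^+ 2 * x ^+ N = (N%:R * z ^+ N) ^+ 2 * (z ^+ 2) ^+ N.
  have gen (a y : R) : a ^+ 2 * (y ^+ 4) ^+ N = (a * y ^+ N) ^+ 2 * (y ^+ 2) ^+ N.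
    by rewrite (exprMn _ a) -!exprM -[RHS]mulrA -exprD; congr (_ * _ ^+ _); lia.
  by rewrite [in LHS]zx gen.
rewrite ler_wpM2r ?exprn_ge0 ?sqr_ge0// lerXn2r// ?nnegrE ?mulr_ge0 ?exprn_ge0//.
by rewrite invr_ge0 ltW.
Unshelve. all: by end_near. Qed.

Section CoshSeries.
Variables (R : realType) (lambda : R).
Hypothesis lambda_gt0 : 0 < lambda.

Let a2 : R := (lambda / (2 * pi)) ^+ 2.
Let P (N : nat) (t : R) := (cosh_trunc a2 N).[sin (pi * t) ^+ 2].
Let a2_ge0 : 0 <= a2. Proof. exact: sqr_ge0. Qed.
Let pi_neq0 : pi != 0 :> R. Proof. by rewrite gt_eqF// pi_gt0. Qed.

(** The error [E] of the partial sum with [N+1] terms, its first two derivatives [E1]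
    and [E2], and the forcing term [rem] of its differential equation. *)
Let E (N : nat) (t : R) := cosh (lambda * t) - P N.+1 t.
Let E1 (N : nat) (t : R) := lambda * sinh (lambda * t) -
  (cosh_trunc a2 N.+1)^`().[sin (pi * t) ^+ 2] * (2 * pi * sin (pi * t) * cos (pi * t)).
Let rem (N : nat) (t : R) : R :=
  4 * pi ^+ 2 * (N%:R ^+ 2 + a2) * cosh_coef a2 N * (sin (pi * t) ^+ 2) ^+ N.
Let E2 (N : nat) (t : R) := lambda ^+ 2 * E N t + rem N t.

Let dE N (t : R) : is_derive t (1 : R) (E N) (E1 N t).
Proof.
have h := is_derive_cosh lambda t.
have h2 := is_derive_horner_sin2 (cosh_trunc a2 N.+1) t.
exact: is_deriveB.
Qed.

Let dE1 N (t : R) : is_derive t (1 : R) (E1 N) (E2 N t).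
Proof.
have h := is_derive_sinh lambda t.
have h2 := is_derive_horner_sin2 (cosh_trunc a2 N.+1)^`() t.
have h3 : is_derive t (1 : R) (fun t => 2 * pi * sin (pi * t) * cos (pi * t))
   (2 * pi ^+ 2 * (1 - 2 * sin (pi * t) ^+ 2)).
  apply: is_derive_eq; rewrite /GRing.scale/=.
  have := cos2sin2 (pi * t).
  transitivity (2 * pi ^+ 2 * (cos (pi * t) ^+ 2 - sin (pi * t) ^+ 2)); first ring.
  rewrite cos2sin2; ring.
have h4 := is_deriveB (is_deriveZ lambda h) (is_deriveM h2 h3).
apply: is_derive_eq.
rewrite /GRing.scale/= /E2 /E /rem /P.
have ode := cosh_trunc_ode a2 N (sin (pi * t) ^+ 2).
cbv zeta in ode.
move: ode; set p := cosh_trunc a2 N.+1; set s := sin _; set c := cos _.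
have hc : c ^+ 2 = 1 - s ^+ 2 by exact: cos2sin2.
have ha : lambda ^+ 2 = 4 * pi ^+ 2 * a2.
  by rewrite /a2; move: (pi : R) pi_neq0 => p' p'0; field.
move=> ode.
transitivity (lambda ^+ 2 * cosh (lambda * t) - 2 * pi ^+ 2 *
  (2 * s ^+ 2 * (1 - s ^+ 2) * p^`()^`().[s ^+ 2] + (1 - 2 * s ^+ 2) * p^`().[s ^+ 2])).
  rewrite -hc; ring.
rewrite ode; transitivity (lambda ^+ 2 * cosh (lambda * t) - 4 * pi ^+ 2 * a2 * p.[s ^+ 2] +
   4 * pi ^+ 2 * (N%:R ^+ 2 + a2) * cosh_coef a2 N * (s ^+ 2) ^+ N); first ring.
rewrite -ha; ring.
Qed.

Let rem_ge0 N (t : R) : 0 <= rem N t.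
Proof.
apply: mulr_ge0; last by rewrite exprn_ge0// sqr_ge0.
apply: mulr_ge0; last exact: cosh_coef_ge0.
by apply: mulr_ge0; [rewrite mulr_ge0// sqr_ge0 | rewrite addr_ge0// sqr_ge0].
Qed.

Let E0 N : E N 0 = 0.
Proof.
rewrite /E /P !mulr0 sin0 expr0n /= horner_cosh_trunc big_ord_recl big1 => [|i _]; last first.
  by rewrite expr0n /= mulr0.
by rewrite /= expr0 /cosh oppr0 expR0; lra.
Qed.

Let E10 N : E1 N 0 = 0.
Proof. by rewrite /E1 !mulr0 sin0 /sinh oppr0 expR0 subrr; lra. Qed.

Let E_ge0_pos N (t : R) : 0 <= t -> 0 <= E N t.
Proof.
move=> t0.
apply: (@second_order_comparison R lambda t (E N) (E1 N) (E2 N)) => //; last by rewrite t0 lexx.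
- by move=> x _; rewrite /E2 lerDl rem_ge0.
Qed.

Let evenE N (t : R) : E N (- t) = E N t.
Proof.
by rewrite /E /P /cosh !mulrN sinN sqrrN opprK [expR (- _) + _]addrC.
Qed.

Let E_ge0 N (t : R) : 0 <= E N t.
Proof.
case: (leP 0 t) => t0; first exact: E_ge0_pos.
by have := @E_ge0_pos N (- t); rewrite evenE; apply; rewrite oppr_ge0 ltW.
Qed.

Let sin2_lt1 (t : R) : 0 <= t < 2^-1 -> sin (pi * t) ^+ 2 < 1.
Proof.
move=> /andP[t0 t1]; have p0 := pi_gt0 R.
rewrite sin2cos2 gtrBl exprn_gt0// cos_gt0_pihalf// ltr_pM2l// t1 andbT.
by have := mulr_ge0 (ltW p0) t0; lra.
Qed.

Let sin2_le (s t : R) : 0 <= s <= t -> t <= 2^-1 -> sin (pi * s) ^+ 2 <= sin (pi * t) ^+ 2.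
Proof.
move=> /andP[s0 st] t1; have p0 := pi_gt0 R.
have bnd (x : R) : 0 <= x -> x <= 2^-1 -> (- (pi / 2) <= pi * x) && (pi * x <= pi / 2).
  move=> x0 x1; apply/andP; split; last by rewrite ler_pM2l.
  by have := mulr_ge0 (ltW p0) x0; lra.
have s1 := le_trans st t1; have t0 := le_trans s0 st.
have sge (x : R) : 0 <= x -> x <= 2^-1 -> 0 <= sin (pi * x).
  move=> x0 x1; have x2 : x <= 1 by lra.
  by apply: sin_ge0_pi; rewrite mulr_ge0 ?(ltW p0)//= ger_pMr.
rewrite lerXn2r ?nnegrE ?sge// leNgt ltr_sin ?in_itv/= ?bnd// -leNgt.
by rewrite ler_pM2l.
Qed.

Let cvgE0 (t : R) : 0 <= t < 2^-1 -> E ^~ t @ \oo --> (0 : R).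
Proof.
move=> /andP[t0 t1]; set u := sin (pi * t) ^+ 2.
have u01 : 0 <= u < 1 by rewrite sqr_ge0 sin2_lt1// t0.
have [M hM] : exists M, forall k, cosh_coef a2 k <= M.
  exists (cosh (lambda * 2^-1)) => k.
  have := E_ge0 k 2^-1; rewrite /E subr_ge0; apply: le_trans.
  rewrite /P sin_pihalf expr1n horner_cosh_trunc (bigD1 ord_max)//= expr1n mulr1 lerDl.
  by apply: sumr_ge0 => i _; rewrite expr1n mulr1 cosh_coef_ge0.
pose eps (N : nat) : R := 4 * pi ^+ 2 * M * (N%:R ^+ 2 * u ^+ N + a2 * u ^+ N).
have eps0 : eps @ \oo --> (0 : R).
  rewrite -[0](mulr0 (4 * pi ^+ 2 * M)); apply: cvgMr.
  rewrite -[0](addr0 0); apply: cvgD; first exact: sqr_expr_cvg0.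
  rewrite -[0](mulr0 a2); apply: cvgMr; apply: cvg_expr.
  by case/andP: u01 => u0 u1; rewrite ger0_norm.
have M0 : 0 <= M by apply: le_trans (hM 0%N); exact: ler01.
have remE N s : 0 <= s <= t -> rem N s <= eps N.
  move=> /andP[s0 st]; rewrite /rem /eps -mulrDl.
  have -> : 4 * pi ^+ 2 * M * ((N%:R ^+ 2 + a2) * u ^+ N) =
    4 * pi ^+ 2 * (N%:R ^+ 2 + a2) * M * u ^+ N by ring.
  have su : sin (pi * s) ^+ 2 <= u by rewrite sin2_le ?s0// ltW.
  have h2 : 0 <= 4 * pi ^+ 2 * (N%:R ^+ 2 + a2) :> R.
    by apply: mulr_ge0; [rewrite mulr_ge0// sqr_ge0 | rewrite addr_ge0// sqr_ge0].
  apply: ler_pM; last by rewrite lerXn2r ?nnegrE ?sqr_ge0.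
  - by rewrite mulr_ge0 ?cosh_coef_ge0.
  - by rewrite exprn_ge0// sqr_ge0.
  - by rewrite ler_wpM2l.
(* [eps (cosh (lambda s) - 1) / lambda^2] solves [F'' = lambda^2 F + eps] with zero
   initial data, and [rem <= eps] on [[0, t]]. *)
have bound N : E N t <= eps N * ((cosh (lambda * t) - 1) / lambda ^+ 2).
  rewrite -subr_ge0.
  pose F (s : R) := eps N * ((cosh (lambda * s) - 1) / lambda ^+ 2) - E N s.
  pose F1 (s : R) := eps N * (lambda * sinh (lambda * s) / lambda ^+ 2) - E1 N s.
  pose F2 (s : R) := eps N * cosh (lambda * s) - E2 N s.
  apply: (@second_order_comparison R lambda t F F1 F2) => //; last by rewrite t0 lexx.
  - move=> s; have h := is_derive_cosh lambda s.
    have h2 : is_derive s (1 : R) (fun s => eps N * ((cosh (lambda * s) - 1) / lambda ^+ 2))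
       (eps N * (lambda * sinh (lambda * s) / lambda ^+ 2)).
      by apply: is_derive_eq; rewrite /GRing.scale/= mulr0 add0r subr0 [_^-1 * _]mulrC.
    exact: is_deriveB h2 (dE N s).
  - move=> s; have h := is_derive_sinh lambda s.
    have h2 : is_derive s (1 : R) (fun s => eps N * (lambda * sinh (lambda * s) / lambda ^+ 2))
       (eps N * cosh (lambda * s)).
      apply: is_derive_eq; rewrite /GRing.scale/= mulr0 add0r [lambda * (lambda * _)]mulrA -expr2.
      by rewrite mulKf// expf_neq0// gt_eqF.
    exact: is_deriveB h2 (dE1 N s).
  - by rewrite /F E0 mulr0 /cosh oppr0 expR0; lra.
  - by rewrite /F1 E10 !mulr0 /sinh oppr0 expR0 subrr; lra.
  - move=> s hs; rewrite /F /F2 /E2 -subr_ge0.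
    have -> : eps N * cosh (lambda * s) - (lambda ^+ 2 * E N s + rem N s) - lambda ^+ 2 *
      (eps N * ((cosh (lambda * s) - 1) / lambda ^+ 2) - E N s) = eps N - rem N s.
      by field; rewrite gt_eqF.
    by rewrite subr_ge0 remE.
apply: (squeeze_cvgr _ (cvg_cst 0)); last first.
  by rewrite -[0](mul0r ((cosh (lambda * t) - 1) / lambda ^+ 2)); apply: cvgMl; exact: eps0.
by near=> N; rewrite E_ge0 bound.
Unshelve. all: by end_near. Qed.

Let PE N t : P N.+1 t = cosh (lambda * t) - E N t.
Proof. by rewrite /E opprB addrC subrK. Qed.

Let P_ndecr t : {homo P ^~ t : n m / (n <= m)%N >-> n <= m}.
Proof.
apply/nondecreasing_seqP => N; rewrite /P !horner_cosh_trunc big_ord_recr /= lerDl.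
by rewrite mulr_ge0 ?cosh_coef_ge0// exprn_ge0// sqr_ge0.
Qed.

Let P_le N t : P N t <= cosh (lambda * t).
Proof.
apply: (@le_trans _ _ (P N.+1 t)); first exact: P_ndecr.
by rewrite PE gerBl E_ge0.
Qed.

Let cvgP (t : R) : 0 <= t <= 2^-1 -> P ^~ t @ \oo --> cosh (lambda * t).
Proof.
have lt_case (s : R) : 0 <= s < 2^-1 -> P ^~ s @ \oo --> cosh (lambda * s).
  move=> hs; rewrite -cvg_shiftS /=.
  rewrite (_ : (fun N => P N.+1 s) = (fun N => cosh (lambda * s) - E N s)); last first.
    by apply/funext => N; rewrite PE.
  by have := cvgB (cvg_cst (cosh (lambda * s))) (cvgE0 hs); rewrite subr0; apply.
move=> /andP[t0]; rewrite le_eqVlt => /predU1P[->|t1]; last by apply: lt_case; rewrite t0.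
have ub : has_ubound (range (P ^~ 2^-1)).
  by exists (cosh (lambda * 2^-1)) => _ [N _ <-]; exact: P_le.
have cv := nondecreasing_is_cvgn (P_ndecr 2^-1) ub.
suff -> : cosh (lambda * 2^-1) = limn (P ^~ 2^-1) by exact: cv.
apply/eqP; rewrite eq_le; apply/andP; split; last first.
  by apply: limr_le => //; near=> N; exact: P_le.
(* [P_N(s) <= P_N(1/2) <= lim P(1/2)] for [s < 1/2]; let [N] tend to infinity,
   then [s] to [1/2]. *)
have step (s : R) : 0 <= s < 2^-1 -> cosh (lambda * s) <= limn (P ^~ 2^-1).
  move=> hs; have /andP[s0 s1] := hs.
  apply: (ler_cvg_to (lt_case s hs) cv); near=> N.
  rewrite /P !horner_cosh_trunc; apply: ler_sum => i _.
  rewrite ler_wpM2l ?cosh_coef_ge0// lerXn2r ?nnegrE ?sqr_ge0//.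
  by apply: sin2_le => //; rewrite s0 ltW.
have cc : {for 2^-1, continuous (fun s : R => cosh (lambda * s))}.
  apply: differentiable_continuous; apply/derivable1_diffP.
  exact: (@ex_derive _ _ _ _ _ _ _ (is_derive_cosh lambda 2^-1)).
have cl : cosh (lambda * s) @[s --> (2^-1 : R)^'-] --> cosh (lambda * 2^-1).
  exact: cvg_at_left_filter cc.
apply: (cvgr_to_le cl); near=> s; apply: step.
by apply/andP; split; near: s; [exact: nbhs_left_ge | exact: nbhs_left_lt].
Unshelve. all: by end_near. Qed.

(** [cosh (lambda t)] is a power series in [sin^2 (pi t)] with nonnegative
    coefficients, on the closed interval [|t| <= 1/2]. *)
Lemma cosh_sin2_series (t : R) : `|t| <= 2^-1 ->
  (fun N => \sum_(k < N) cosh_coef a2 k * (sin (pi * t) ^+ 2) ^+ k) @ \oo -->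
  cosh (lambda * t).
Proof.
move=> ht.
have -> : (fun N => \sum_(k < N) cosh_coef a2 k * (sin (pi * t) ^+ 2) ^+ k) = P ^~ `|t|.
  apply/funext => N; rewrite /P horner_cosh_trunc.
  by case: (ger0P t) => t0; rewrite ?mulrN ?sinN ?sqrrN.
have -> : cosh (lambda * t) = cosh (lambda * `|t|).
  by case: (ger0P t) => t0 //; rewrite /cosh !mulrN opprK addrC.
by apply: cvgP; rewrite normr_ge0.
Qed.

End CoshSeries.

Lemma cosD2piz (R : realType) (x : R) (m : int) : cos (x + 2 * pi * m%:~R) = cos x.
Proof.
have pos (y : R) (k : nat) : cos (y + 2 * pi * k%:R) = cos y.
  by rewrite mulr_natr mulr_natl (periodicn (@cosD2pi R)).
case: m => k; first exact: pos.
by rewrite NegzE mulrNz mulrN -[LHS](pos _ k.+1) subrK.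
Qed.

(** In [u = (1 + cos (2 pi theta)) / 2], which is [sin^2 (pi t)] for
    [t = theta - floor theta - 1/2], [flambda] is a power series with nonnegative
    coefficients, convergent everywhere including at the corner [u = 1]. *)
Lemma flambda_series (R : realType) (lambda : R) : 0 < lambda ->
  exists2 c : nat -> R, (forall k, 0 <= c k) & forall theta : R,
    (fun N => \sum_(k < N) c k * ((1 + cos (2 * pi * theta)) / 2) ^+ k) @ \oo -->
    flambda lambda theta.
Proof.
move=> l0; set a2 := (lambda / (2 * pi)) ^+ 2.
have s0 : 0 < sinh (lambda / 2) by rewrite sinh_gt0// divr_gt0.
exists (fun k => (sinh (lambda / 2))^-1 * cosh_coef a2 k) => [k|theta].
  by rewrite mulr_ge0 ?cosh_coef_ge0 ?sqr_ge0// invr_ge0 ltW.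
set t := theta - (Num.floor theta)%:~R - 2^-1.
have ht : `|t| <= 2^-1.
  have /andP[h1 h2] := floor_itv theta; rewrite intrD1 in h2.
  by rewrite ler_norml /t; apply/andP; split; lra.
have -> : (1 + cos (2 * pi * theta)) / 2 = sin (pi * t) ^+ 2.
  rewrite sin2cos2.
  have -> : cos (pi * t) ^+ 2 = (1 + cos ((pi * t) *+ 2)) / 2.
    by rewrite cos_mulr2n -mulr_natl; lra.
  have -> : (pi * t) *+ 2 = 2 * pi * theta - pi + 2 * pi * (- Num.floor theta)%:~R.
    by rewrite /t -mulr_natl intrN; move: (pi : R) => p; field.
  by rewrite cosD2piz cosB cospi sinpi mulr0 addr0; lra.
under eq_fun do under eq_bigr do rewrite -mulrA.
under eq_fun do rewrite -mulr_sumr.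
rewrite /flambda -/t [_ / sinh _]mulrC.
by apply: cvgMr; exact: cosh_sin2_series.
Qed.

(** * Interpolants of power series with nonnegative coefficients *)

(** Synthetic division by [X - a] with [a >= 0] keeps coefficients nonnegative:
    each coefficient of the quotient is a value at [a] of a quotient of [p] by a power
    of [X]. *)
Lemma divp_XsubC_nneg (R : realFieldType) (a : R) (p : {poly R}) : 0 <= a ->
  (forall i, 0 <= p`_i) -> forall i, 0 <= (p %/ ('X - a%:P))`_i.
Proof.
move=> a0; elim/poly_ind: p => [|q c ih] hp; first by move=> i; rewrite div0p coef0.
have hq i : 0 <= q`_i by have := hp i.+1; rewrite coefD coefMX coefC addr0.
set d := 'X - a%:P.
have e : q * 'X + c%:P = (q %/ d * 'X + (q.[a])%:P) * d + (q.[a] * a + c)%:P.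
  have := divp_eq q d; rewrite modp_XsubC => eq; rewrite {1}eq /d.
  by rewrite polyCD polyCM; ring.
rewrite e divp_addl_mul_small ?size_XsubC; last first.
  exact: leq_ltn_trans (size_polyC_leq1 _) _.
have qa : 0 <= q.[a].
  by rewrite horner_coef sumr_ge0// => i _; rewrite mulr_ge0 ?exprn_ge0.
move=> i; rewrite coefD coefMX coefC addr_ge0//; first by case: ifP => // _; exact: ih.
by case: ifP.
Qed.

Lemma divp_prod_XsubC_nneg (R : realFieldType) (s : seq R) (p : {poly R}) :
  {in s, forall a, 0 <= a} -> (forall i, 0 <= p`_i) ->
  forall i, 0 <= (p %/ \prod_(a <- s) ('X - a%:P))`_i.
Proof.
elim: s p => [|a s ih] p hs hp; first by rewrite big_nil divp1.
rewrite big_cons -divp_divl; apply: ih => [b bs|].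
  by apply: hs; rewrite inE bs orbT.
by apply: divp_XsubC_nneg => //; apply: hs; rewrite inE eqxx.
Qed.

Lemma is_cvg_sum_ord (R : realType) (k : nat) (u : 'I_k -> R ^nat) :
  (forall i, cvgn (u i)) ->
  (fun N => \sum_(i < k) u i N) @ \oo --> \sum_(i < k) limn (u i).
Proof.
elim: k u => [|k ih] u hu.
  by rewrite big_ord0; under eq_fun do rewrite big_ord0; exact: cvg_cst.
rewrite big_ord_recl; under eq_fun do rewrite big_ord_recl.
by apply: cvgD; [exact: hu | apply: ih => i; exact: hu].
Qed.

Section InterpolationLimit.
Variables (R : realType) (c : nat -> R) (s : seq R).
Hypothesis c_ge0 : forall k, 0 <= c k.
Hypothesis s_ge0 : {in s, forall a, 0 <= a}.

Let W := \prod_(a <- s) ('X - a%:P).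
Let P (N : nat) : {poly R} := \poly_(k < N) c k.

Lemma series_quotient_ge0 N i : 0 <= (P N %/ W)`_i.
Proof.
apply: divp_prod_XsubC_nneg => // {}i.
by rewrite coef_poly; case: ifP.
Qed.

Lemma series_quotient_ndecr j : {homo (fun N => (P N %/ W)`_j) : n m / (n <= m)%N >-> n <= m}.
Proof.
apply/nondecreasing_seqP => N; rewrite {2}/P poly_def big_ord_recr /= -poly_def divpD coefD lerDl.
apply: divp_prod_XsubC_nneg => // i; rewrite coefZ coefXn.
by case: eqP; rewrite ?mulr1 ?mulr0.
Qed.

(** The remainders of the partial sums [P N] modulo [W], i.e. their Hermite
    interpolants at the roots of [W], converge as soon as each coefficient of
    the quotients, which is nondecreasing in [N], is bounded. *)
Lemma interpolant_cvg : (forall j, exists M, forall N, (P N %/ W)`_j <= M) ->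
  exists2 h : {poly R}, (size h <= size s)%N &
    forall v, (fun N => (P N %% W).[v]) @ \oo --> h.[v].
Proof.
move=> bnd.
have sW : size W = (size s).+1 by rewrite size_prod_XsubC.
have W0 : W != 0 by rewrite -size_poly_gt0 sW.
have cG j : cvgn (fun N => (P N %/ W)`_j).
  have [M hM] := bnd j; apply: nondecreasing_is_cvgn; first exact: series_quotient_ndecr.
  by exists M => _ [N _ <-].
have cP j : cvgn (fun N => (P N)`_j).
  apply/cvg_ex; exists (c j); apply: cvg_near_cst; near=> N.
  by rewrite coef_poly ifT//; near: N; exact: nbhs_infty_gt.
have cH j : cvgn (fun N => (P N %% W)`_j).
  have -> : (fun N => (P N %% W)`_j) =
     (fun N => (P N)`_j - \sum_(i < j.+1) (P N %/ W)`_i * W`_(j - i)).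
    apply/funext => N; rewrite [in X in X - _](divp_eq (P N) W) coefD coefM.
    by rewrite addrC addKr.
  apply: is_cvgB => //; apply/cvg_ex; eexists; apply: is_cvg_sum_ord => i.
  by apply: is_cvgMl.
exists (\poly_(j < size s) limn (fun N => (P N %% W)`_j)); first exact: size_poly.
move=> v; rewrite horner_poly.
have -> : (fun N => (P N %% W).[v]) = (fun N => \sum_(j < size s) (P N %% W)`_j * v ^+ j).
  apply/funext => N; apply: horner_coef_wide.
  by rewrite -ltnS -sW ltn_modp.
have h := @is_cvg_sum_ord R (size s) (fun j N => (P N %% W)`_j * v ^+ j).
have -> : \sum_(i < size s) limn (fun N : nat => (P N %% W)`_i) * v ^+ i =
  \sum_(i < size s) limn (fun N : nat => (P N %% W)`_i * v ^+ i).
  by apply: eq_bigr => i _; apply/esym/cvg_lim => //; apply: cvgMl; exact: cH.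
by apply: h => i; exact: is_cvgMl.
Unshelve. all: by end_near. Qed.

End InterpolationLimit.

(** * Integrals of bounded continuous complex functions *)

Section BoundedContinuous.
Variable R : realType.
Implicit Types f g : R -> R.

(** Bounded continuous functions are integrable for every probability measure; all
    the integrands below are of this kind. *)
Definition bounded_continuous f :=
  continuous f /\ exists M, forall x, `|f x| <= M.

Lemma bcont_cst (a : R) : bounded_continuous (fun=> a).
Proof. by split; [exact: cst_continuous | exists `|a|]. Qed.

Lemma bcontD f g : bounded_continuous f -> bounded_continuous g ->
  bounded_continuous (fun x => f x + g x).
Proof.
move=> [cf [M hM]] [cg [N hN]]; split; first by move=> x; apply: cvgD; [exact: cf | exact: cg].
exists (M + N) => x; exact: le_trans (ler_normD _ _) (lerD (hM x) (hN x)).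
Qed.

Lemma bcontM f g : bounded_continuous f -> bounded_continuous g ->
  bounded_continuous (fun x => f x * g x).
Proof.
move=> [cf [M hM]] [cg [N hN]]; split; first by move=> x; apply: cvgM; [exact: cf | exact: cg].
by exists (M * N) => x; rewrite normrM ler_pM.
Qed.

Lemma bcontN f : bounded_continuous f -> bounded_continuous (fun x => - f x).
Proof.
move=> [cf [M hM]]; split; first by move=> x; apply: cvgN; exact: cf.
by exists M => x; rewrite normrN.
Qed.

Lemma bcont_cos (a : R) : bounded_continuous (fun x => cos (a * x)).
Proof.
split; last by exists 1 => x; exact: cos_max.
move=> x; apply: (continuous_comp (f := fun x => a * x)); last exact: continuous_cos.
exact: mulrl_continuous.
Qed.

Lemma bcont_sin (a : R) : bounded_continuous (fun x => sin (a * x)).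
Proof.
split; last by exists 1 => x; exact: sin_max.
move=> x; apply: (continuous_comp (f := fun x => a * x)); last exact: continuous_sin.
exact: mulrl_continuous.
Qed.

Lemma bcont_integrable (mu : probability (measurableTypeR R) R) f :
  bounded_continuous f -> mu.-integrable setT (EFin \o f).
Proof.
move=> [cf [M hM]]; apply: measurable_bounded_integrable => //.
- exact: (le_lt_trans (probability_le1 mu measurableT) (ltry 1)).
- exact: measurable_realfun.continuous_measurable_fun.
- exists M; split; first by rewrite num_real.
  by move=> y My x _ /=; apply: le_trans (hM x) (ltW My).
Qed.

End BoundedContinuous.

Section ComplexFunctions.
Variable R : realType.
Local Notation C := R[i].
Implicit Types f g : R -> C.

(** The same, for the real and imaginary parts of a complex function. *)
Definition cbounded_continuous f :=
  bounded_continuous (fun x => Re (f x)) /\ bounded_continuous (fun x => Im (f x)).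

Lemma cReM (x y : C) : Re (x * y) = Re x * Re y - Im x * Im y.
Proof. by case: x y => a b [c d]. Qed.
Lemma cImM (x y : C) : Im (x * y) = Re x * Im y + Im x * Re y.
Proof. by case: x y => a b [c d]. Qed.
Lemma cReD (x y : C) : Re (x + y) = Re x + Re y.
Proof. by case: x y => a b [c d]. Qed.
Lemma cImD (x y : C) : Im (x + y) = Im x + Im y.
Proof. by case: x y => a b [c d]. Qed.
Lemma cReJ (x : C) : Re x^* = Re x.
Proof. by case: x. Qed.
Lemma cImJ (x : C) : Im x^* = - Im x.
Proof. by case: x. Qed.
Lemma complex_eqP (x y : C) : Re x = Re y -> Im x = Im y -> x = y.
Proof. by case: x y => a b [c d] /= -> ->. Qed.

Lemma cbcont_cst (a : C) : cbounded_continuous (fun=> a).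
Proof. by split; exact: bcont_cst. Qed.

Lemma cbcontD f g : cbounded_continuous f -> cbounded_continuous g ->
  cbounded_continuous (fun x => f x + g x).
Proof.
move=> [f1 f2] [g1 g2]; split.
  by under eq_fun do rewrite cReD; exact: bcontD.
by under eq_fun do rewrite cImD; exact: bcontD.
Qed.

Lemma cbcontM f g : cbounded_continuous f -> cbounded_continuous g ->
  cbounded_continuous (fun x => f x * g x).
Proof.
move=> [f1 f2] [g1 g2]; split.
  by under eq_fun do rewrite cReM; apply: bcontD; [|apply: bcontN]; exact: bcontM.
by under eq_fun do rewrite cImM; apply: bcontD; exact: bcontM.
Qed.

Lemma cbcontJ f : cbounded_continuous f -> cbounded_continuous (fun x => (f x)^*).
Proof.
move=> [f1 f2]; split.
  by under eq_fun do rewrite cReJ; exact: f1.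
by under eq_fun do rewrite cImJ; exact: bcontN.
Qed.

Lemma cbcont_ecirc (k : R) : cbounded_continuous (fun x => ecirc (k * x)).
Proof.
split => /=; under eq_fun do rewrite mulrA; [exact: bcont_cos | exact: bcont_sin].
Qed.

Lemma cbcont_horner (P : {poly C}) : cbounded_continuous (fun x => P.[ecirc x]).
Proof.
elim/poly_ind: P => [|P c ih]; first by under eq_fun do rewrite horner0; exact: cbcont_cst.
under eq_fun do rewrite !hornerE.
apply: cbcontD; last exact: cbcont_cst.
by apply: cbcontM => //; have := cbcont_ecirc 1; under eq_fun do rewrite mul1r.
Qed.

Variable mu : probability (measurableTypeR R) R.

Lemma cintegralD f g : cbounded_continuous f -> cbounded_continuous g ->
  cintegral mu (fun x => f x + g x) = cintegral mu f + cintegral mu g.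
Proof.
move=> [f1 f2] [g1 g2]; apply: complex_eqP; rewrite ?cReD ?cImD /=.
  rewrite -RintegralD//; try exact: bcont_integrable.
  by apply: eq_Rintegral => x _; rewrite cReD.
rewrite -RintegralD//; try exact: bcont_integrable.
by apply: eq_Rintegral => x _; rewrite cImD.
Qed.

Lemma cintegralZ (a : C) f : cbounded_continuous f ->
  cintegral mu (fun x => a * f x) = a * cintegral mu f.
Proof.
move=> [f1 f2].
have i1 := bcont_integrable mu f1; have i2 := bcont_integrable mu f2.
have z (r : R) (g : R -> R) : bounded_continuous g -> mu.-integrable setT (EFin \o (fun x => r * g x)).
  by move=> hg; apply: bcont_integrable; apply: bcontM => //; exact: bcont_cst.
apply: complex_eqP; rewrite ?cReM ?cImM /=.
  under eq_Rintegral do rewrite cReM.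
  by rewrite RintegralB ?RintegralZl//; exact: z.
under eq_Rintegral do rewrite cImM.
by rewrite RintegralD ?RintegralZl//; exact: z.
Qed.

Lemma cintegralJ f : cbounded_continuous f ->
  cintegral mu (fun x => (f x)^*) = (cintegral mu f)^*.
Proof.
move=> [f1 f2]; apply: complex_eqP; rewrite ?cReJ ?cImJ /=.
  by apply: eq_Rintegral => x _; rewrite cReJ.
rewrite -mulN1r -RintegralZl//; last exact: bcont_integrable.
by apply: eq_Rintegral => x _; rewrite cImJ mulN1r.
Qed.

Lemma ecircD (x y : R) : ecirc (x + y) = ecirc x * ecirc y.
Proof.
apply: complex_eqP; rewrite ?cReM ?cImM /= !mulrDr; first by rewrite cosD.
by rewrite sinD addrC.
Qed.

Lemma ecirc_conj (x : R) : (ecirc x)^* = ecirc (- x).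
Proof. by apply: complex_eqP; rewrite ?cReJ ?cImJ /= mulrN ?cosN ?sinN. Qed.

Lemma ecirc0 : ecirc 0 = 1 :> C.
Proof. by apply: complex_eqP; rewrite /= mulr0 ?cos0 ?sin0. Qed.

Lemma ecirc_mulJ (x : R) : ecirc x * (ecirc x)^* = 1.
Proof. by rewrite ecirc_conj -ecircD subrr ecirc0. Qed.

Lemma ecirc_neq0 (x : R) : ecirc x != 0 :> C.
Proof. by apply/eqP => h; have /eqP := ecirc_mulJ x; rewrite h mul0r eq_sym oner_eq0. Qed.

Lemma ecircV (x : R) : (ecirc x)^-1 = (ecirc x)^*.
Proof. by apply: (mulfI (ecirc_neq0 x)); rewrite ecirc_mulJ mulfV// ecirc_neq0. Qed.

Lemma ecircX (x : R) (k : nat) : ecirc (k%:R * x) = ecirc x ^+ k.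
Proof.
elim: k => [|k ih]; first by rewrite mul0r ecirc0 expr0.
by rewrite -natr1 mulrDl mul1r ecircD ih exprSr.
Qed.

End ComplexFunctions.

(** * The inner product of a measure on the circle *)

Lemma poly_wide (K : nzRingType) (Q : {poly K}) d : (size Q <= d)%N ->
  Q = \sum_(i < d) Q`_i *: 'X^i.
Proof.
move=> hd; rewrite -(poly_def d (fun i => Q`_i)); apply/polyP => i; rewrite coef_poly.
by case: ltnP => // hi; rewrite nth_default// (leq_trans hd).
Qed.

Section InnerProduct.
Variables (R : realType) (mu : probability (measurableTypeR R) R).
Local Notation C := R[i].
Implicit Types P Q S : {poly C}.

(** The inner product of L^2 of the circle for the image of [mu], on polynomials. *)
Definition ip P Q : C := cintegral mu (fun x => P.[ecirc x] * (Q.[ecirc x])^*).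

Lemma cbcont_ip P Q : cbounded_continuous (fun x => P.[ecirc x] * (Q.[ecirc x])^*).
Proof. by apply: cbcontM; [|apply: cbcontJ]; exact: cbcont_horner. Qed.

Lemma ipDl P1 P2 Q : ip (P1 + P2) Q = ip P1 Q + ip P2 Q.
Proof.
rewrite /ip -cintegralD; try exact: cbcont_ip.
by congr cintegral; apply/funext => x; rewrite hornerD mulrDl.
Qed.

Lemma ipZl (a : C) P Q : ip (a *: P) Q = a * ip P Q.
Proof.
rewrite /ip -cintegralZ; last exact: cbcont_ip.
by congr cintegral; apply/funext => x; rewrite hornerZ mulrA.
Qed.

Lemma ipC P Q : ip Q P = (ip P Q)^*.
Proof.
rewrite /ip -cintegralJ; last exact: cbcont_ip.
by congr cintegral; apply/funext => x; rewrite rmorphM /= conjCK mulrC.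
Qed.

Lemma ipZr (a : C) P Q : ip P (a *: Q) = a^* * ip P Q.
Proof. by rewrite ipC ipZl rmorphM /= -ipC. Qed.

Lemma ipNl P Q : ip (- P) Q = - ip P Q.
Proof. by rewrite -scaleN1r ipZl mulN1r. Qed.

Lemma ipBl P1 P2 Q : ip (P1 - P2) Q = ip P1 Q - ip P2 Q.
Proof. by rewrite ipDl ipNl. Qed.

Lemma ip0l Q : ip 0 Q = 0.
Proof. by rewrite -[0]subr0 ipBl subrr. Qed.

Lemma ip_suml (I : Type) (r : seq I) (F : I -> {poly C}) Q :
  ip (\sum_(i <- r) F i) Q = \sum_(i <- r) ip (F i) Q.
Proof.
elim: r => [|i r ih]; first by rewrite !big_nil ip0l.
by rewrite !big_cons ipDl ih.
Qed.

Lemma ip_sumr (I : Type) (r : seq I) P (F : I -> {poly C}) :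
  ip P (\sum_(i <- r) F i) = \sum_(i <- r) ip P (F i).
Proof. by rewrite ipC ip_suml rmorph_sum /=; apply: eq_bigr => i _; rewrite -ipC. Qed.

Lemma ip_coefr P Q d : (size Q <= d)%N ->
  ip P Q = \sum_(i < d) (Q`_i)^* * ip P 'X^i.
Proof.
move=> hd; rewrite [in LHS](poly_wide hd) ip_sumr.
by apply: eq_bigr => i _; rewrite ipZr.
Qed.

(** Multiplication by [X] is an isometry, because [X] has modulus 1 on the circle. *)
Lemma ipMX P Q : ip (P * 'X) (Q * 'X) = ip P Q.
Proof.
congr cintegral; apply/funext => x; rewrite !hornerMX rmorphM mulrACA ecirc_mulJ mulr1 //.
Qed.

(** [|P|^2] at the point [ecirc x] of the circle, as a real number. *)
Definition sqnorm P (x : R) : R := Re P.[ecirc x] ^+ 2 + Im P.[ecirc x] ^+ 2.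

Lemma sqnormE P x : (sqnorm P x)%:C%C = P.[ecirc x] * (P.[ecirc x])^*.
Proof.
rewrite /sqnorm; case: (P.[ecirc x]) => a b; apply: complex_eqP; rewrite ?cReM ?cImM /=; ring.
Qed.

Lemma sqnorm_normc P x : sqnorm P x = normc P.[ecirc x] ^+ 2.
Proof. by rewrite /sqnorm; case: (P.[ecirc x]) => a b /=; rewrite sqr_sqrtr// addr_ge0 ?sqr_ge0. Qed.

Lemma sqnorm_ge0 P x : 0 <= sqnorm P x.
Proof. by rewrite addr_ge0 ?sqr_ge0. Qed.

Lemma bcont_sqnorm P : bounded_continuous (sqnorm P).
Proof.
have [h1 h2] := cbcont_horner P.
by apply: bcontD; exact: bcontM.
Qed.

Lemma ip_sqnorm P : ip P P = (\int[mu]_x sqnorm P x)%:C%C.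
Proof.
rewrite /ip; under eq_fun do rewrite -sqnormE.
by apply: complex_eqP => //=; rewrite Rintegral_cst// mul0r.
Qed.

Lemma ip_ge0 P : 0 <= ip P P.
Proof. by rewrite ip_sqnorm ler0c Rintegral_ge0// => x _; exact: sqnorm_ge0. Qed.

Lemma normL2_sqr P : ((normL2 mu P) ^+ 2)%:C%C = ip P P.
Proof.
rewrite ip_sqnorm /normL2 sqr_sqrtr; last by rewrite Rintegral_ge0// => x _; rewrite sqr_ge0.
by congr (_%:C)%C; apply: eq_Rintegral => x _; rewrite sqnorm_normc.
Qed.

(** On the circle [P] is Lipschitz at any point [z]: [P - P(z)] is divisible by [X - z]. *)
Lemma poly_lipschitz_circle P (z : C) : exists B : R, 0 < B /\
  forall x, normc (P.[ecirc x] - P.[z]) <= normc (ecirc x - z) * B.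
Proof.
have /factor_theorem [q hq] : root (P - (P.[z])%:P) z.
  by rewrite /root !hornerE subrr.
have [_ [M hM]] := bcont_sqnorm q.
exists (1 + `|M|); split; first by rewrite ltr_pwDl.
move=> x; have -> : P.[ecirc x] - P.[z] = (ecirc x - z) * q.[ecirc x].
  by have := congr1 (horner^~ (ecirc x)) hq; rewrite !hornerE mulrC.
have n0 (w : C) : 0 <= normc w by case: w => a b /=; exact: sqrtr_ge0.
rewrite ComplexField.Normc.normcM ler_wpM2l//.
have h1 := hM x; rewrite ger0_norm ?sqnorm_ge0// sqnorm_normc in h1.
have h2 := ler_norm M; have h3 := n0 q.[ecirc x].
rewrite expr2 in h1; nra.
Qed.

Section Nontrivial.
Hypothesis mu_nontrivial : nontrivial_measure mu.

(** The measure is not carried by the zeros of a nonzero polynomial: off the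
    zeros, near a point of the support, [|P|^2] is bounded below on a set of
    positive measure. *)
Lemma ip_gt0 P : P != 0 -> 0 < ip P P.
Proof.
move=> P0; rewrite lt_def ip_ge0 andbT; apply/eqP => ip0.
apply: mu_nontrivial.
have [r hr] := closed_field_poly_normal P.
apply: (@sub_finite_set _ _ [set` r]); last exact: finite_seq.
move=> z hz /=; apply/negPn/negP => zr.
have Pz : P.[z] != 0.
  rewrite hr hornerZ mulf_neq0 ?lead_coef_eq0// -[_ == 0]/(root _ z).
  by rewrite root_prod_XsubC.
set c := normc P.[z].
have c0 : 0 < c.
  rewrite lt_def; apply/andP; split; last first.
    by rewrite /c; case: (P.[z]) => a b /=; exact: sqrtr_ge0.
  by apply: contra Pz => /eqP/ComplexField.Normc.eq0_normc ->.
have [B [B0 hB]] := poly_lipschitz_circle P z.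
have eps0 : 0 < c / (2 * B) by rewrite divr_gt0// mulr_gt0.
pose A := [set x : measurableTypeR R | normc (ecirc x - z) < c / (2 * B)].
have A0 x : A x -> sqnorm P x != 0.
  move=> Ax; rewrite sqnorm_normc expf_eq0 /=; apply/eqP => Px0.
  have := hB x; rewrite (ComplexField.Normc.eq0_normc Px0) sub0r.
  rewrite normcN -/c leNgt => /negP; apply.
  rewrite -ltr_pdivlMr// (lt_le_trans Ax)//.
  by rewrite ler_pM2l// lef_pV2 ?posrE ?mulr_gt0//; lra.
have mA : measurable A.
  pose G (x : measurableTypeR R) : R := sqnorm ('X - z%:P) x.
  have mG : measurable_fun setT G.
    apply: measurable_realfun.continuous_measurable_fun.
    by case: (bcont_sqnorm ('X - z%:P)).
  have -> : A = setT `&` G @^-1` `]-oo, (c / (2 * B)) ^+ 2[%classic.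
    rewrite setTI; apply/seteqP; split=> x;
      rewrite /A /G /= in_itv/= sqnorm_normc hornerXsubC ltr_pXn2r ?nnegrE//; try exact: ltW;
      by case: (ecirc x - z) => a b /=; exact: sqrtr_ge0.
  exact: mG.
have iF := bcont_integrable mu (bcont_sqnorm P).
have mF := measurable_int mu iF.
have I0 : (\int[mu]_x `|(EFin \o sqnorm P) x|)%E = 0%E.
  under eq_integral do rewrite gee0_abs ?lee_fin ?sqnorm_ge0//.
  have := ip0; rewrite ip_sqnorm => -[]; rewrite /Rintegral => h.
  rewrite -[LHS]fineK ?h//; exact: (integrable_fin_num _ iF).
have /(ae_eq_integral_abs mu measurableT mF) h := I0.
have : mu A = 0%E.
  apply: measure_negligible => //; apply: negligibleS h => x Ax /= hx.
  by have /eqP := A0 x Ax; apply; have [] := hx I.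
by move=> h0; have := hz _ eps0; rewrite -/A h0 ltxx.
Qed.

End Nontrivial.

Section Even.
Hypothesis mu_even : even_measure mu.

(** Evenness: [Im (z^k)] and [- Im (z^k)] have the same distribution. *)
Lemma even_moment_Im (k : nat) : \int[mu]_x Im (ecirc x ^+ k) = 0.
Proof.
pose Y (x : measurableTypeR R) : R := Im (ecirc x ^+ k).
have bY : bounded_continuous Y.
  have [_] := cbcont_horner ('X^k : {poly C}); under eq_fun do rewrite hornerXn.
  exact.
have mY : measurable_fun setT Y by apply: measurable_realfun.continuous_measurable_fun; case: bY.
have mYN : measurable_fun setT (fun x => - Y x).
  by apply: measurable_realfun.continuous_measurable_fun; case: (bcontN bY).
have iY := bcont_integrable mu bY.
have iYN := bcont_integrable mu (bcontN bY).
have e : (\int[pushforward mu Y]_y y%:E = \int[pushforward mu (fun x => - Y x)%R]_y y%:E)%E.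
  apply: eq_measure_integral => T mT _.
  change (mu (ecirc @^-1` [set z : C | T (Im (z ^+ k))]) = mu ((fun x => - Y x) @^-1` T)).
  rewrite mu_even; last by rewrite -[X in measurable X]setTI; exact: mY.
  congr (mu _); apply/seteqP; split => x /=.
    move=> [z hz e]; rewrite /Y -e -rmorphXn cImJ opprK //.
  move=> hT; exists (ecirc x)^*; last by rewrite conjCK.
  by rewrite /= -rmorphXn cImJ.
rewrite !integral_pushforward//= in e.
have : \int[mu]_x Y x = \int[mu]_x (- Y x) by rewrite /Rintegral e.
have -> : \int[mu]_x (- Y x) = - \int[mu]_x Y x.
  rewrite -mulN1r -RintegralZl//; by apply: eq_Rintegral => x _; rewrite mulN1r.
by rewrite /Y => h; lra.
Qed.

Lemma ipXX_real (j k : nat) : (ip 'X^j 'X^k)^* = ip 'X^j 'X^k.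
Proof.
wlog kj : j k / (k <= j)%N.
  move=> h; case: (leqP k j) => kj; first exact: h.
  by rewrite (ipC 'X^k 'X^j) conjCK h// ltnW.
have -> : ip 'X^j 'X^k = cintegral mu (fun x => ecirc x ^+ (j - k)).
  congr cintegral; apply/funext => x; rewrite !hornerXn rmorphXn /=.
  by rewrite -{1}(subnK kj) exprD -mulrA -exprMn ecirc_mulJ expr1n mulr1.
by apply: complex_eqP; rewrite ?cReJ ?cImJ //= even_moment_Im oppr0.
Qed.

Lemma ip_conj P Q : ip (map_poly Num.conj P) (map_poly Num.conj Q) = (ip P Q)^*.
Proof.
have hs (S : {poly C}) : (size (map_poly Num.conj S) <= size S)%N by exact: size_poly.
rewrite (ip_coefr _ (hs Q)) (ip_coefr P (leqnn (size Q))) rmorph_sum /=.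
apply: eq_bigr => j _; rewrite rmorphM /= coef_map /=; congr (_ * _).
rewrite ipC -[in RHS]ipC (ip_coefr _ (hs P)) (ip_coefr _ (leqnn (size P))) rmorph_sum /=.
apply: eq_bigr => i _; rewrite rmorphM /= coef_map /= !conjCK.
by rewrite ipXX_real.
Qed.

End Even.
End InnerProduct.

(** * Orthogonal polynomials *)

Section Orthogonal.
Variables (R : realType) (mu : probability (measurableTypeR R) R).
Hypothesis mu_nontrivial : nontrivial_measure mu.
Local Notation C := R[i].
Local Notation ip := (ip mu).

Lemma ip_eq0 (P : {poly C}) : ip P P = 0 -> P = 0.
Proof.
move=> h; apply/eqP; apply: contraT => P0.
by have := ip_gt0 mu_nontrivial P0; rewrite h ltxx.
Qed.

Lemma ip_orth_small (P Q : {poly C}) d : (size Q <= d)%N ->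
  (forall j, (j < d)%N -> ip P 'X^j = 0) -> ip P Q = 0.
Proof.
move=> hQ hP; rewrite (ip_coefr _ _ hQ); apply: big1 => i _.
by rewrite hP// mulr0.
Qed.

Lemma monic_orthP m (P : {poly C}) : monic_orth mu m P <->
  [/\ size P = m.+1, P \is monic & forall j, (j < m)%N -> ip P 'X^j = 0].
Proof.
have e j : ip P 'X^j = cintegral mu (fun x => P.[ecirc x] * (ecirc x)^* ^+ j).
  by congr cintegral; apply/funext => x; rewrite hornerXn rmorphXn.
by split=> -[h1 h2 h3]; split=> // j hj; [rewrite e h3 | rewrite -e h3].
Qed.

Lemma gram_row_free m : row_free (\matrix_(i < m, j < m) ip 'X^i 'X^j).
Proof.
set G := \matrix_(_, _) _.
apply: inj_row_free => v hv.
have sV : (size (rVpoly v) <= m)%N by exact: size_poly.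
suff : rVpoly v = 0 by move/(congr1 (@poly_rV C m)); rewrite rVpolyK linear0.
apply: ip_eq0; apply: (ip_orth_small sV) => j jm.
have := congr1 (fun B : 'rV[C]_m => B 0 (Ordinal jm)) hv; rewrite !mxE => h.
rewrite (poly_wide sV) ip_suml -[RHS]h; apply: eq_bigr => i _.
by rewrite ipZl mxE coef_rVpoly_ord.
Qed.

Lemma monic_orth_exists m : exists P, monic_orth mu m P.
Proof.
pose G : 'M[C]_m := \matrix_(i < m, j < m) ip 'X^i 'X^j.
have uG : G \in unitmx by rewrite -row_free_unit gram_row_free.
pose b : 'rV[C]_m := \row_j ip 'X^m 'X^j.
have [v hv] : exists v, v *m G = b by exists (b *m invmx G); exact: mulmxKV.
pose V : {poly C} := \sum_(i < m) v 0 i *: 'X^i.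
have sV : (size V <= m)%N.
  apply: (leq_trans (size_sum _ _ _)); apply/bigmax_leqP => i _.
  by apply: leq_trans (size_scale_leq _ _) _; rewrite size_polyXn.
have sP : size ('X^m - V : {poly C}) = m.+1.
  by rewrite size_polyDl ?size_polyXn// size_polyN.
exists ('X^m - V); apply/monic_orthP; split=> //.
  by rewrite monicE lead_coefDl ?lead_coefXn// size_polyXn size_polyN.
move=> j jm; rewrite ipBl /V ip_suml.
have := congr1 (fun B : 'rV[C]_m => B 0 (Ordinal jm)) hv.
rewrite !mxE => <-; apply/eqP; rewrite subr_eq0; apply/eqP.
by apply: eq_bigr => i _; rewrite ipZl mxE.
Qed.

Lemma monic_orth_uniq m (P Q : {poly C}) :
  monic_orth mu m P -> monic_orth mu m Q -> P = Q.
Proof.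
move=> /monic_orthP[sP mP oP] /monic_orthP[sQ mQ oQ].
apply/eqP; rewrite -subr_eq0; apply/eqP; apply: ip_eq0.
apply: (@ip_orth_small _ _ m) => [|j jm]; last by rewrite ipBl oP// oQ// subrr.
rewrite -ltnS -sP ltn_neqAle; apply/andP; split; last first.
  by rewrite (leq_trans (size_polyD _ _))// geq_max size_polyN sP sQ leqnn.
apply/eqP => h; have : lead_coef (P - Q) = 0.
  rewrite lead_coefE h sP /= coefB.
  have -> : P`_m = 1 by rewrite -(monicP mP) lead_coefE sP.
  have -> : Q`_m = 1 by rewrite -(monicP mQ) lead_coefE sQ.
  by rewrite subrr.
by move/eqP; rewrite lead_coef_eq0 => /eqP e; move: h; rewrite e size_poly0 sP.
Qed.

Lemma Phi_monic_orth m : monic_orth mu m (Phi mu m).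
Proof. by have [P hP] := monic_orth_exists m; exact: (xgetPex 0 (ex_intro _ P hP)). Qed.

Let N m := normL2 mu (Phi mu m).

Let N_gt0 m : 0 < N m.
Proof.
have /monic_orthP[_ mP _] := Phi_monic_orth m.
rewrite lt_def sqrtr_ge0 andbT; apply/eqP => h.
have := ip_gt0 mu_nontrivial (monic_neq0 mP).
by rewrite -normL2_sqr -/(N m) h expr0n ltxx.
Qed.

Let kappa_neq0 m : (((N m)^-1)%:C)%C != 0.
Proof. by rewrite (inj_eq (@complexI R)) invr_neq0// gt_eqF. Qed.

Lemma size_phi m : size (phi mu m) = m.+1.
Proof.
have /monic_orthP[sP _ _] := Phi_monic_orth m.
by rewrite /phi size_scale ?sP// kappa_neq0.
Qed.

Lemma phi_orth m j : (j < m)%N -> ip (phi mu m) 'X^j = 0.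
Proof.
have /monic_orthP[_ _ oP] := Phi_monic_orth m.
by move=> jm; rewrite /phi ipZl oP// mulr0.
Qed.

(** With leading coefficient [kappa = 1 / |Phi|], [<phi, X^m> = <phi, Phi> = |Phi| = 1 / kappa]. *)
Lemma phi_lead m : (phi mu m)`_m * ip (phi mu m) 'X^m = 1.
Proof.
have /monic_orthP[sP mP oP] := Phi_monic_orth m.
have hm : (Phi mu m)`_m = 1 by rewrite -(monicP mP) lead_coefE sP.
have : ip (Phi mu m) (Phi mu m) = ip (Phi mu m) 'X^m.
  rewrite (ip_coefr _ _ (leqnn _)) sP big_ord_recr /= big1 ?add0r => [|i _].
    by rewrite hm rmorph1 mul1r.
  by rewrite oP ?mulr0.
rewrite -normL2_sqr -/(N m) => h.
rewrite /phi -/(N m) coefZ hm mulr1 ipZl -h -!rmorphM /=.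
by rewrite mulrA -invfM -expr2 mulVf// expf_neq0// gt_eqF.
Qed.

(** For an even measure the conjugate of [Phi] is again monic orthogonal. *)
Lemma phi_real m : even_measure mu -> map_poly Num.conj (phi mu m) = phi mu m.
Proof.
move=> ev; have hP := Phi_monic_orth m; have /monic_orthP[sP mP oP] := hP.
rewrite /phi -/(N m); set k := ((N m)^-1)%:C%C.
have kJ : k^* = k by apply: complex_eqP; rewrite ?cReJ ?cImJ //= oppr0.
rewrite map_polyZ /= kJ; congr (_ *: _).
apply: (@monic_orth_uniq m) => //; apply/monic_orthP; split.
- by rewrite size_map_poly.
- by rewrite map_monic.
- move=> j jm; have -> : 'X^j = map_poly Num.conj ('X^j : {poly C}) by rewrite map_polyXn.
  by rewrite ip_conj// oP// rmorph0.
Qed.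

End Orthogonal.

(** * Para-orthogonal polynomials and quadrature on their zeros *)

Section ParaOrthogonal.
Variables (R : realType) (mu : probability (measurableTypeR R) R).
Hypothesis mu_nontrivial : nontrivial_measure mu.
Local Notation C := R[i].
Local Notation ip := (ip mu).
Variables (n : nat) (p : {poly C}) (tau : C).
Hypothesis size_p : size p = n.+2.
Hypothesis p_orth : forall j, (j <= n)%N -> ip p 'X^j = 0.
Hypothesis p_lead : p`_n.+1 * ip p 'X^(n.+1) = 1.
Hypothesis p_real : map_poly Num.conj p = p.
Hypothesis tau_sqr : tau * tau = 1.
Hypothesis tau_real : tau^* = tau.

(** The para-orthogonal polynomial [p* + tau p], for an abstract [p] with the properties
    of the orthonormal polynomial of degree [n+1] of an even measure. *)
Definition paraorth : {poly C} := recip p + tau *: p.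
Local Notation q := (recip p).
Local Notation Y := paraorth.
Local Notation kappa := (p`_n.+1).

Lemma coef_pJ i : (p`_i)^* = p`_i.
Proof. by rewrite -{2}p_real coef_map. Qed.

Lemma coef_recip i : (i <= n.+1)%N -> q`_i = p`_(n.+1 - i).
Proof. by move=> hi; rewrite coef_poly size_p ltnS hi /= coef_pJ. Qed.

Lemma kappa_neq0 : kappa != 0.
Proof. by apply: contra_eq_neq p_lead => ->; rewrite mul0r eq_sym oner_eq0. Qed.

Lemma recip_ecirc x : q.[ecirc x] = ecirc x ^+ n.+1 * (p.[ecirc x])^*.
Proof. by rewrite recip_horner ?ecirc_neq0// size_p -ecircV invrK. Qed.

Lemma ip_recip j : (j <= n.+1)%N -> ip q 'X^j = (ip p 'X^(n.+1 - j))^*.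
Proof.
move=> hj; rewrite -ipC; congr cintegral; apply/funext => x.
rewrite recip_ecirc !hornerXn -[in LHS](subnK hj) exprD rmorphXn /=.
transitivity (ecirc x ^+ (n.+1 - j) * (p.[ecirc x])^* * (ecirc x * (ecirc x)^*) ^+ j).
  by rewrite exprMn; ring.
by rewrite ecirc_mulJ expr1n mulr1.
Qed.

Lemma ip_p_lead : ip p 'X^(n.+1) = kappa^-1.
Proof. by apply: (mulfI kappa_neq0); rewrite p_lead mulfV ?kappa_neq0. Qed.

Lemma ip_paraorth_mid j : (1 <= j <= n)%N -> ip Y 'X^j = 0.
Proof.
move=> /andP[j1 jn]; rewrite ipDl ipZl p_orth// mulr0 addr0 ip_recip ?leqW//.
by rewrite p_orth ?rmorph0//; lia.
Qed.

Lemma ip_paraorth0 : ip Y 'X^0 = kappa^-1.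
Proof.
rewrite ipDl ipZl p_orth// mulr0 addr0 ip_recip// subn0 ip_p_lead.
by rewrite fmorphV /= coef_pJ.
Qed.

Lemma ip_paraorth_top : ip Y 'X^(n.+1) = tau / kappa.
Proof. by rewrite ipDl ipZl ip_recip// subnn p_orth// rmorph0 add0r ip_p_lead. Qed.

Lemma coef_paraorth i : (i <= n.+1)%N -> Y`_i = p`_(n.+1 - i) + tau * p`_i.
Proof. by move=> hi; rewrite coefD coefZ coef_recip. Qed.

Lemma coef_paraorth_sym i : (i <= n.+1)%N -> Y`_(n.+1 - i) = tau * Y`_i.
Proof.
move=> hi; rewrite !coef_paraorth ?leq_subr// subKn// mulrDr mulrA tau_sqr mul1r.
by rewrite addrC.
Qed.

Lemma paraorthJ : map_poly Num.conj Y = Y.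
Proof.
apply/polyP => i; rewrite coef_map /= coefD coefZ rmorphD rmorphM /= tau_real coef_pJ.
congr (_ + _); case: (leqP i n.+1) => hi; first by rewrite coef_recip// coef_pJ.
by rewrite nth_default ?rmorph0// (leq_trans (size_poly _ _))// size_p.
Qed.

Lemma size_paraorth_le : (size Y <= n.+2)%N.
Proof.
rewrite (leq_trans (size_polyD _ _))// geq_max (leq_trans (size_poly _ _)) ?size_p//.
by rewrite (leq_trans (size_scale_leq _ _)) ?size_p.
Qed.

Lemma paraorth_coef0 : Y`_0 != 0.
Proof.
apply/eqP => h.
have h' : Y`_n.+1 = 0 by rewrite -[n.+1]subn0 coef_paraorth_sym// h mulr0.
have : ip Y Y = 0.
  rewrite (ip_coefr _ _ size_paraorth_le) big_ord_recr big_ord_recl /= h h' rmorph0 !mul0r.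
  rewrite add0r addr0; apply: big1 => i _.
  by rewrite ip_paraorth_mid ?mulr0//= ltn_ord.
move=> /(ip_eq0 mu_nontrivial) Y0.
have := ip_paraorth0; rewrite Y0 ip0l => /esym/eqP.
by rewrite invr_eq0 (negbTE kappa_neq0).
Qed.

Lemma paraorth_lead_neq0 : Y`_n.+1 != 0.
Proof.
rewrite -[n.+1]subn0 coef_paraorth_sym// mulf_neq0 ?paraorth_coef0//.
by apply: contra_eq_neq tau_sqr => ->; rewrite mul0r eq_sym oner_eq0.
Qed.

Lemma size_paraorth : size Y = n.+2.
Proof.
apply/eqP; rewrite eqn_leq size_paraorth_le /= ltnNge; apply/negP => h.
by move: paraorth_lead_neq0; rewrite nth_default ?eqxx.
Qed.

Lemma paraorth_neq0 : Y != 0.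
Proof. by rewrite -size_poly_gt0 size_paraorth. Qed.

(** On the circle, [(w - z) (w - 1/conj z)] is [- w |w - z|^2 / conj z]; hence a
    factor of this form would make [Y] orthogonal to [X M] and yet
    [<Y, X M> = - |(X - z) M|^2 / conj z <> 0]. *)
Lemma paraorth_no_inverse_pair (z : C) (M : {poly C}) : z != 0 ->
  Y <> ('X - z%:P) * (('X - ((z^*)^-1)%:P) * M).
Proof.
move=> z0 hY.
have zJ0 : z^* != 0 by rewrite conjC_eq0.
have M0 : M != 0 by apply/eqP => h; move: paraorth_neq0; rewrite hY h !mulr0 eqxx.
have sM : size M = n.
  have := size_paraorth; rewrite hY !size_mul ?mulf_neq0 ?polyXsubC_eq0// !size_XsubC.
  by move=> [].
have h1 : ip Y (M * 'X) = 0.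
  have sMX : (size (M * 'X)%R <= n.+1)%N by rewrite size_mulX// sM.
  rewrite (ip_coefr _ _ sMX) big_ord_recl coefMX /= rmorph0 mul0r add0r.
  by apply: big1 => i _; rewrite ip_paraorth_mid ?mulr0//= ltn_ord.
have h2 : ip Y (M * 'X) = - (z^*)^-1 * ip (('X - z%:P) * M) (('X - z%:P) * M).
  rewrite -ipZl; congr cintegral; apply/funext => x.
  rewrite hY !hornerE !rmorphM rmorphB /=.
  set e := ecirc x; have ee : e * e^* = 1 by exact: ecirc_mulJ.
  transitivity ((e - z) * M.[e] * ((M.[e])^* * (e * e^* - (z^*)^-1 * e^*))); first ring.
  by rewrite ee; field.
have := ip_gt0 mu_nontrivial (mulf_neq0 (negbT (polyXsubC_eq0 z)) M0).
move: h1; rewrite h2 => /eqP; rewrite mulf_eq0 oppr_eq0 invr_eq0 (negbTE zJ0) /=.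
by move=> /eqP ->; rewrite ltxx.
Qed.

Lemma recip_paraorth : recip Y = tau *: Y.
Proof.
apply/polyP => i; rewrite coef_poly size_paraorth coefZ; case: ltnP => hi.
  by rewrite /= coef_paraorth_sym// rmorphM /= tau_real -[in RHS]paraorthJ coef_map.
by rewrite nth_default ?mulr0// size_paraorth.
Qed.

Lemma paraorth_root_neq0 z : root Y z -> z != 0.
Proof.
by apply: contraTneq => ->; rewrite rootE horner_coef0 paraorth_coef0.
Qed.

Lemma paraorth_conj_root z : root Y z -> root Y (z^*)^-1.
Proof.
move=> rz; have z0 := paraorth_root_neq0 rz.
have := recip_horner Y z0; rewrite recip_paraorth hornerZ (rootP rz) mulr0 => /esym/eqP.
by rewrite mulf_eq0 expf_eq0 (negbTE z0) andbF conjC_eq0.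
Qed.

Lemma paraorth_root_circle z : root Y z -> z * z^* = 1.
Proof.
move=> rz; have z0 := paraorth_root_neq0 rz; have rw := paraorth_conj_root rz.
have zJ0 : z^* != 0 by rewrite conjC_eq0.
have [e|ne] := eqVneq (z^*)^-1 z; first by rewrite -{1}e mulVf.
have /factor_theorem [M1 h1] := rz.
have /factor_theorem [M2 h2] : root M1 (z^*)^-1.
  move: rw; rewrite h1 rootM root_XsubC (negbTE ne) orbF; exact.
exfalso; apply: (@paraorth_no_inverse_pair z M2 z0).
by rewrite h1 h2; ring.
Qed.

Lemma not_uniq_perm (T : eqType) (s : seq T) : ~~ uniq s ->
  exists z s', perm_eq s [:: z, z & s'].
Proof.
elim: s => [//|a s ih] /=; rewrite negb_and negbK => /orP[ain|/ih [z [s' hs]]].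
  by exists a, (rem a s); rewrite perm_cons perm_to_rem.
exists z, (a :: s'); apply: (@perm_trans _ (a :: [:: z, z & s'])); first by rewrite perm_cons.
by rewrite -(cat1s a) -(cat1s z [:: z & _]) -(cat1s z (a :: _)) perm_catCA perm_cons
   -(cat1s a) -(cat1s z) perm_catCA.
Qed.

(** The zeros of [Y] are simple and on the unit circle. *)
Lemma paraorth_roots : exists r : seq C, [/\ uniq r, size r = n.+1,
  Y = Y`_n.+1 *: \prod_(z <- r) ('X - z%:P) & r =i root Y].
Proof.
have [r hr] := closed_field_poly_normal Y.
have l0 : lead_coef Y != 0 by rewrite lead_coef_eq0 paraorth_neq0.
have lE : lead_coef Y = Y`_n.+1 by rewrite lead_coefE size_paraorth.
have mr z : (z \in r) = root Y z by rewrite hr rootZ// root_prod_XsubC.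
exists r; split => //; last 2 first.
- by apply/eqP; rewrite -eqSS -(size_prod_XsubC _ idfun) -(size_scale _ l0) -hr size_paraorth.
- by rewrite -lE.
apply: contraT => /not_uniq_perm [z [s' hs]]; exfalso.
have rz : root Y z by rewrite -mr (perm_mem hs) inE eqxx.
have e : (z^*)^-1 = z.
  apply: (mulfI (x := z^*)); first by rewrite conjC_eq0 paraorth_root_neq0.
  by rewrite mulfV ?conjC_eq0 ?paraorth_root_neq0// mulrC paraorth_root_circle.
apply: (@paraorth_no_inverse_pair z (lead_coef Y *: \prod_(z <- s') ('X - z%:P))).
  exact: paraorth_root_neq0.
by rewrite e [LHS]hr (perm_big _ hs) /= !big_cons -!scalerAr.
Qed.

(** For a zero [z] of [Y]: the unnormalized Lagrange polynomial [Y / (X - z)],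
    its inner product with [X^n], and the weight of [z] in the quadrature. *)
Definition lag (z : C) : {poly C} := Y %/ ('X - z%:P).
Definition lag_moment (z : C) : C := ip (lag z) 'X^n.
Definition quad_weight (z : C) : C := z ^+ n * lag_moment z / (lag z).[z].

Section AtRoot.
Variable z : C.
Hypothesis rz : root Y z.
Local Notation L := (lag z).
Local Notation m := (lag_moment z).

Let z0 : z != 0. Proof. exact: paraorth_root_neq0. Qed.
Let zz : z * z^* = 1. Proof. exact: paraorth_root_circle. Qed.

Lemma lagE : Y = L * ('X - z%:P).
Proof.
by have /factor_theorem [M h] := rz; rewrite {1}h /lag h mulpK// polyXsubC_eq0.
Qed.

Lemma lag_neq0 : L != 0.
Proof. by apply/eqP => h; move: paraorth_neq0; rewrite lagE h mul0r eqxx. Qed.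

Lemma size_lag : size L = n.+1.
Proof.
have := size_paraorth; rewrite {1}lagE size_mul ?lag_neq0 ?polyXsubC_eq0// size_XsubC.
by rewrite addn2 => -[].
Qed.

Lemma ip_lag_shift j : ip L 'X^j = ip Y 'X^(j.+1) + z * ip L 'X^(j.+1).
Proof.
rewrite -ipMX -exprSr; have -> : L * 'X = Y + z *: L.
  by rewrite lagE mulrBr -mul_polyC mulrC [L * _%:P]mulrC subrK.
by rewrite ipDl ipZl.
Qed.

(** The moments of [L = Y / (X - z)] form a geometric progression:
    [X L = Y + z L], and [Y] is orthogonal to [X, ..., X^n]. *)
Lemma ip_lag j : (j <= n)%N -> ip L 'X^j = z ^+ (n - j) * m.
Proof.
move=> hj; rewrite -{1}(subKn hj); move: (leq_subr j n); move: (n - j)%N => k {hj}.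
elim: k => [|k ih] hk; first by rewrite subn0 expr0 mul1r.
rewrite ip_lag_shift -subSn// subSS ip_paraorth_mid ?add0r ?ih ?exprS ?mulrA//; first exact: ltnW.
by rewrite subn_gt0 hk leq_subr.
Qed.

Lemma ip_lag_top : z * ip L 'X^(n.+1) = m - tau / kappa.
Proof. by rewrite /lag_moment (ip_lag_shift n) ip_paraorth_top addrAC subrr add0r. Qed.

Let zXJ i d : (i <= d)%N -> z ^+ d * (z ^+ i)^* = z ^+ (d - i).
Proof.
by move=> hi; rewrite -{1}(subnK hi) exprD -mulrA rmorphXn -exprMn zz expr1n mulr1.
Qed.

Lemma recip_root : q.[z] = z ^+ n.+1 * (p.[z])^*.
Proof.
rewrite recip_horner// size_p /=; congr (_ * (p.[_])^*).
by apply: (mulfI (x := z^*)); rewrite ?conjC_eq0// mulfV ?conjC_eq0// mulrC zz.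
Qed.

(** This value comes from [<L, p> = 0], the degree of [L] being at most [n]. *)
Lemma lag_moment_recip : m * q.[z] = tau.
Proof.
have : z * ip L p = 0.
  have hL : (size L <= n.+1)%N by rewrite size_lag.
  by rewrite ipC (ip_orth_small hL) ?rmorph0 ?mulr0.
have hp : (size p <= n.+2)%N by rewrite size_p.
rewrite (ip_coefr _ _ hp) big_ord_recr /= mulrDr mulrCA ip_lag_top.
rewrite mulrBr coef_pJ mulrCA mulfV ?kappa_neq0// mulr1 addrA => /eqP.
rewrite subr_eq0 => /eqP <-.
rewrite recip_root horner_coef size_p rmorph_sum /= mulr_sumr mulr_sumr big_ord_recr /=.
congr (_ + _); last first.
  by rewrite rmorphM /= coef_pJ [z ^+ _ * (_ * _)]mulrCA zXJ// subnn mulr1 mulrC.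
rewrite mulr_sumr; apply: eq_bigr => i _; have hi : (i <= n)%N := leq_ord i.
rewrite rmorphM /= [z ^+ _ * (_ * _)]mulrCA zXJ; last exact: ltnW.
by rewrite ip_lag// subSn// exprS; ring.
Qed.

Lemma p_root : p.[z] = - tau * q.[z].
Proof.
have := rootP rz; rewrite /paraorth hornerD hornerZ => /eqP.
rewrite addr_eq0 => /eqP ->; rewrite mulrNN mulrA tau_sqr mul1r //.
Qed.

Lemma ip_lag_lag : ip L L = m * z ^+ n * (L.[z])^*.
Proof.
have hL : (size L <= n.+1)%N by rewrite size_lag.
rewrite (ip_coefr _ _ hL) horner_coef size_lag rmorph_sum /= mulr_sumr.
apply: eq_bigr => i _; have hi : (i <= n)%N := leq_ord i.
by rewrite rmorphM /= ip_lag// -(zXJ hi); ring.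
Qed.

Lemma lag_root_neq0 : L.[z] != 0.
Proof.
have := ip_gt0 mu_nontrivial lag_neq0; rewrite ip_lag_lag.
by apply: contraTneq => ->; rewrite rmorph0 mulr0 ltxx.
Qed.

Lemma quad_weight_gt0 : 0 < quad_weight z.
Proof.
have h := ip_gt0 mu_nontrivial lag_neq0.
have : quad_weight z * (L.[z] * (L.[z])^*) = ip L L.
  by rewrite ip_lag_lag /quad_weight; field; exact: lag_root_neq0.
have : 0 < L.[z] * (L.[z])^* by rewrite mul_conjC_gt0 lag_root_neq0.
by move=> h2 h3; rewrite -(pmulr_lgt0 _ h2) h3.
Qed.

(** The Christoffel-Darboux quotient at a zero of [Y] is a multiple of the
    Lagrange polynomial. *)
Lemma cd_quotient_root w : w != z ->
  (q.[w] * (q.[z])^* - p.[w] * (p.[z])^*) / (1 - z^* * w) = - z * (q.[z])^* * L.[w].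
Proof.
move=> wz.
have d0 : 1 - z^* * w != 0.
  apply: contra wz; rewrite subr_eq0 => /eqP h; apply/eqP.
  by apply: (mulfI (x := z^*)); rewrite ?conjC_eq0// -h mulrC zz.
apply: (mulIf d0); rewrite mulfVK//.
have hY : L.[w] * (w - z) = q.[w] + tau * p.[w].
  have e : Y.[w] = q.[w] + tau * p.[w] by rewrite /paraorth hornerD hornerZ.
  by rewrite -e -hornerXsubC -hornerM -lagE.
rewrite p_root rmorphM rmorphN /= tau_real.
transitivity ((q.[z])^* * (L.[w] * (w - z))); first by rewrite hY; ring.
transitivity (- ((q.[z])^* * L.[w] * (z - (z * z^*) * w))); last ring.
by rewrite zz; ring.
Qed.

(** The value of the Christoffel-Darboux quotient at the zero itself is the inverse
    of the weight. *)
Lemma quad_weightE : - z * (q.[z])^* * L.[z] * quad_weight z = 1.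
Proof.
rewrite /quad_weight; transitivity (- (z ^+ n.+1 * (q.[z])^*) * m).
  rewrite exprS; field; exact: lag_root_neq0.
rewrite recip_root rmorphM /= mulrA zXJ// subnn expr0 mul1r conjCK p_root.
by rewrite !mulNr opprK -mulrA [_ * m]mulrC lag_moment_recip tau_sqr.
Qed.

End AtRoot.

Lemma lag_root_eq0 z w : root Y z -> root Y w -> w != z -> (lag z).[w] = 0.
Proof.
move=> rz rw wz; have := rootP rw; rewrite (lagE rz) !hornerE => /eqP.
by rewrite mulf_eq0 subr_eq0 (negbTE wz) orbF => /eqP.
Qed.

Lemma ip_paraorth_mul (Q : {poly C}) : (size Q <= n)%N -> ip (Q * Y) 'X^n = 0.
Proof.
move=> hQ; rewrite (poly_wide hQ) mulr_suml ip_suml big1// => i _.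
rewrite -scalerAl ipZl; have hi := ltn_ord i.
have shift k (S T : {poly C}) : ip (S * 'X^k) (T * 'X^k) = ip S T.
  elim: k S T => [|k ih] S T; first by rewrite expr0 !mulr1.
  by rewrite exprSr !mulrA ipMX ih.
have e : 'X^n = 'X^(n - i) * 'X^i :> {poly C} by rewrite -exprD subnK// ltnW.
rewrite ['X^i * Y]mulrC e shift ip_paraorth_mid ?mulr0//.
by rewrite subn_gt0 hi leq_subr.
Qed.

(** Quadrature on the zeros of [Y]: divide by [Y] and interpolate the remainder. *)
Lemma quadrature (r : seq C) (D : {poly C}) : uniq r -> size r = n.+1 ->
  r =i root Y -> (size D <= n.*2.+1)%N ->
  ip D 'X^n = \sum_(z <- r) quad_weight z * (D.[z] * (z^*) ^+ n).
Proof.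
move=> ur sr rr sD.
have root_r z : z \in r -> root Y z by rewrite rr.
have sq : (size (D %/ Y)%R <= n)%N.
  by rewrite size_divp ?paraorth_neq0// size_paraorth /= leq_subLR addSn addnn.
rewrite {1}(divp_eq D Y) ipDl ip_paraorth_mul// add0r.
have srem : (size (D %% Y)%R <= n.+1)%N by rewrite -ltnS -size_paraorth ltn_modp paraorth_neq0.
pose I : {poly C} := \sum_(z <- r) (D.[z] / (lag z).[z]) *: lag z.
have eI : D %% Y = I.
  apply/eqP; rewrite -subr_eq0; apply: contraT => h.
  suff : (size r < size (D %% Y - I)%R)%N.
    rewrite sr ltnNge => /negP []; rewrite (leq_trans (size_polyD _ _))// geq_max srem size_polyN.
    apply: (leq_trans (size_sum _ _ _)); apply/bigmax_leqP_seq => z zr _.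
    by rewrite (leq_trans (size_scale_leq _ _))// size_lag// root_r.
  apply: max_poly_roots => //; apply/allP => w wr; rewrite rootE hornerD hornerN.
  rewrite horner_mod ?root_r// /I horner_sum (bigD1_seq w)//= big_seq_cond big1 ?addr0.
    by rewrite hornerZ mulfVK ?subrr// lag_root_neq0// root_r.
  move=> z /andP[zr zw]; rewrite hornerZ (lag_root_eq0 (root_r _ zr) (root_r _ wr)) ?mulr0//.
  by rewrite eq_sym.
rewrite eI ip_suml; apply: eq_big_seq => z zr.
have zJn : (z^*) ^+ n * z ^+ n = 1.
  by rewrite -exprMn mulrC paraorth_root_circle ?expr1n// root_r.
rewrite ipZl -/(lag_moment z) /quad_weight.
transitivity (D.[z] / (lag z).[z] * lag_moment z * ((z^*) ^+ n * z ^+ n)); last ring.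
by rewrite zJn mulr1.
Qed.

End ParaOrthogonal.

Lemma continuous_horner_num (K : numFieldType) (P : {poly K}) :
  continuous ((fun x => P.[x]) : K^o -> K^o).
Proof.
elim/poly_ind: P => [|P c ih].
  have -> : ((fun x => 0.[x]) : K^o -> K^o) = (fun=> 0) by apply/funext => y; rewrite horner0.
  exact: cst_continuous.
have -> : ((fun x => (P * 'X + c%:P).[x]) : K^o -> K^o) = (fun x => P.[x] * x + c).
  by apply/funext => y; rewrite !hornerE.
move=> x; have F : Filter (nbhs (x : K^o)) := nbhs_filter _.
apply: (@cvgD K K^o _ _ F (fun y => P.[y] * y) (fun=> c)); last exact: cvg_cst.
by apply: (@cvgM K _ _ F (fun y => P.[y]) id); [exact: ih | exact: cvg_id].
Qed.

Lemma Kn_root (R : realType) (mu : probability (measurableTypeR R) R) n (tau z : R[i]) :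
  nontrivial_measure mu -> even_measure mu -> tau * tau = 1 -> tau^* = tau ->
  root (paraorth (phi mu n.+1) tau) z ->
  (Kn mu n z z)^-1 = quad_weight mu n (phi mu n.+1) tau z.
Proof.
move=> nt ev t2 tJ rz.
have sp : size (phi mu n.+1) = n.+2 by exact: size_phi.
have po j : (j <= n)%N -> ip mu (phi mu n.+1) 'X^j = 0 by move=> hj; exact: phi_orth.
have pl := phi_lead nt n.+1.
have pr := phi_real nt n.+1 ev.
have zz := paraorth_root_circle nt sp po pl pr t2 tJ rz.
have E := quad_weightE nt sp po pl pr t2 tJ rz.
set c := - z * ((recip (phi mu n.+1)).[z])^* in E.
rewrite /Kn mulrC zz eqxx.
have -> : lim ((kernel_quotient mu n z : R[i]^o -> R[i]^o) @ (z : R[i]^o)^') =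
    c * (lag (phi mu n.+1) tau z).[z].
  apply: cvg_lim; first exact: norm_hausdorff.
  pose Q := c *: lag (phi mu n.+1) tau z.
  rewrite -hornerZ -/Q.
  have h : ((fun w => Q.[w]) : R[i]^o -> R[i]^o) @ (z : R[i]^o)^' --> (Q.[z] : R[i]^o).
    by apply/continuous_withinNx; exact: continuous_horner_num.
  apply: cvg_trans h; apply: near_eq_cvg; near=> w.
  rewrite /kernel_quotient (cd_quotient_root nt sp po pl pr t2 tJ rz) ?hornerZ//.
  by near: w; exact: nbhs_dnbhs_neq.
by apply: (mulfI (x := c * (lag (phi mu n.+1) tau z).[z])); rewrite ?mulfV// ?E//;
  apply: contra_eq_neq E => ->; rewrite mul0r eq_sym oner_eq0.
Unshelve. all: by end_near. Qed.

(** * Points of the circle and trigonometric polynomials *)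

Section Circle.
Variable R : realType.
Local Notation C := R[i].

Lemma ecirc_eq1 (d : R) : 0 <= d < 1 -> ecirc d = 1 -> d = 0.
Proof.
move=> /andP[d0 d1] h; apply/eqP; rewrite eq_le d0 andbT leNgt; apply/negP => dp.
have p0 := pi_gt0 R.
have s0 : 0 < sin (pi * d) by apply: sin_gt0_pi; rewrite mulr_gt0//= gtr_pMr.
have : cos (2 * pi * d) = 1 by have := congr1 (@Re R) h.
have -> : 2 * pi * d = (pi * d) *+ 2 by rewrite -mulrA mulr_natl.
rewrite cos_mulr2n cos2sin2 => h1.
have : 0 < sin (pi * d) ^+ 2 by rewrite exprn_gt0.
by move: h1; rewrite mulr2n; lra.
Qed.

Lemma ecirc_inj (x y : R) : 0 <= x < 1 -> 0 <= y < 1 -> ecirc x = ecirc y -> x = y.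
Proof.
wlog xy : x y / y <= x => [H hx hy e|/andP[x0 x1] /andP[y0 y1] e].
  by case: (leP y x) => h; [exact: H | apply/esym/H => //; exact: ltW].
apply/eqP; rewrite -subr_eq0; apply/eqP; apply: ecirc_eq1.
  by rewrite subr_ge0 xy/=; lra.
by rewrite ecircD -ecirc_conj e ecirc_mulJ.
Qed.

Lemma Re_circle_bound (z : C) : z * z^* = 1 -> -1 <= Re z <= 1.
Proof.
move=> hz; have := congr1 (@Re R) hz; rewrite cReM cReJ cImJ /= => ab.
by have := sqr_ge0 (Im z); rewrite expr2 => h; apply/andP; split; nra.
Qed.

Lemma ecirc_surj (z : C) : z * z^* = 1 -> exists2 x : R, 0 <= x < 1 & ecirc x = z.
Proof.
move=> hz; have ab : Re z ^+ 2 + Im z ^+ 2 = 1.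
  by have := congr1 (@Re R) hz; rewrite cReM cReJ cImJ /= => <-; ring.
have p0 := pi_gt0 R.
have bn := Re_circle_bound hz.
have [/andP[h0 h1] hc] := acos_def bn.
set th := acos (Re z) in h0 h1 hc.
have hs : sin th ^+ 2 = Im z ^+ 2 by rewrite sin2cos2 hc; lra.
have s0 : 0 <= sin th by apply: sin_ge0_pi; rewrite h0.
have e1 : 2 * pi * (th / (2 * pi)) = th by rewrite mulrCA mulfV ?mulr1// mulf_neq0// gt_eqF.
have x1 : th / (2 * pi) <= 2^-1.
  by rewrite ler_pdivrMr ?mulr_gt0// mulrA mulVf ?mul1r.
have x0 : 0 <= th / (2 * pi) by rewrite divr_ge0// mulr_ge0// ltW.
case: (leP 0 (Im z)) => b0.
  exists (th / (2 * pi)); first by rewrite x0/=; lra.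
  apply: complex_eqP; rewrite /= e1//.
  by apply/eqP; rewrite -(eqrXn2 (n := 2)) ?hs.
have th0 : 0 < th.
  rewrite lt_def h0 andbT; apply: contraTneq b0 => e.
  have : Im z ^+ 2 = 0 by rewrite -hs e sin0 expr0n.
  by move/eqP; rewrite sqrf_eq0 => /eqP ->; rewrite ltxx.
have xp : 0 < th / (2 * pi) by rewrite divr_gt0// mulr_gt0.
exists (1 - th / (2 * pi)); first by apply/andP; split; lra.
have e2 : 2 * pi * (1 - th / (2 * pi)) = - th + pi *+ 2.
  by rewrite mulrBr e1 mulr1 mulr_natl addrC.
apply: complex_eqP; rewrite /= e2; first by rewrite cosD2pi cosN.
rewrite sinD2pi sinN; apply/eqP; rewrite eqr_oppLR.
by rewrite -(eqrXn2 (n := 2)) ?sqrrN ?hs// oppr_ge0 ltW.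
Qed.

(** The representative in [0, 1[ of a point of the unit circle. *)
Definition circ_arg (z : C) : R := xget 0 [set x | 0 <= x < 1 /\ ecirc x = z].

Lemma circ_argP z : z * z^* = 1 -> 0 <= circ_arg z < 1 /\ ecirc (circ_arg z) = z.
Proof.
move=> hz; have [x hx ex] := ecirc_surj hz.
by apply: (@xgetPex _ 0 [set x | 0 <= x < 1 /\ ecirc x = z]); exists x.
Qed.

Lemma circ_argK z : z * z^* = 1 -> ecirc (circ_arg z) = z.
Proof. by move=> /circ_argP[]. Qed.

Lemma sum_circle_zeros (P : {poly C}) (r : seq C) (F : R -> C) : uniq r ->
  (forall z, z \in r -> z * z^* = 1) -> (forall z, (z \in r) = root P z) ->
  \sum_(xi \in circle_zeros P) F xi = \sum_(z <- r) F (circ_arg z).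
Proof.
move=> ur hr rr.
have -> : circle_zeros P = [set` map circ_arg r].
  apply/seteqP; split => x /=.
    move=> [hx /eqP Px]; apply/mapP; exists (ecirc x); first by rewrite rr.
    have [h1 h2] := circ_argP (ecirc_mulJ x).
    exact: ecirc_inj.
  move=> /mapP[z zr ->]; have [h1 h2] := circ_argP (hr z zr).
  by split=> //; apply/eqP; rewrite h2 -[_ == 0]/(root P z) -rr.
rewrite -fsbig_seq ?big_map// map_inj_in_uniq// => z w zr wr e.
by rewrite -(circ_argK (hr z zr)) e circ_argK// hr.
Qed.

(** The coordinate [(1 + Re z) / 2], which maps the unit circle onto [0, 1] and
    identifies conjugate points. *)
Definition node (z : C) : R := (1 + Re z) / 2.

Lemma node_bound (z : C) : z * z^* = 1 -> 0 <= node z <= 1.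
Proof. by move=> /Re_circle_bound /andP[h1 h2]; rewrite /node; apply/andP; split; lra. Qed.

Lemma nodeE (z : C) : (4 * node z)%:C%C = 2 + z + z^*.
Proof. by apply: complex_eqP; rewrite ?cReD ?cImD ?cReJ ?cImJ /node/=; [lra | ring]. Qed.

(** A polynomial of degree at most [n] in [node z] is a trigonometric polynomial
    of degree at most [n]. *)
Lemma node_poly_lift (n : nat) (h : {poly R}) : (size h <= n.+1)%N ->
  exists2 D : {poly C}, (size D <= n.*2.+1)%N &
    forall z, z * z^* = 1 -> D.[z] * (z^*) ^+ n = (h.[node z])%:C%C.
Proof.
move=> sh.
pose B (j : nat) : {poly C} := 'X^(n - j) * (1 + 'X) ^+ j.*2.
exists (\sum_(j < n.+1) (h`_j / 4 ^+ j)%:C%C *: B j).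
  apply: (leq_trans (size_sum _ _ _)); apply/bigmax_leqP => j _.
  apply: (leq_trans (size_scale_leq _ _)); apply: (leq_trans (size_polyMleq _ _)).
  rewrite size_polyXn /=.
  have : (size ((1 + 'X : {poly C}) ^+ j.*2)%R <= j.*2.+1)%N.
    apply: (leq_trans (size_poly_exp_leq _ _)).
    by rewrite addrC -(opprK 1) -polyCN size_XsubC mul1n.
  move: (size _) (leq_ord j) => S hj hS; rewrite -!addnn in hS *; lia.
move=> z zz; rewrite horner_sum mulr_suml (horner_coef_wide _ sh) rmorph_sum /=.
apply: eq_bigr => j _; have hj : (j <= n)%N := leq_ord j.
have hB : (B j).[z] = z ^+ (n - j) * (1 + z) ^+ j.*2.
  by rewrite /B hornerM hornerXn horner_exp hornerD hornerX -polyC1 hornerC.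
rewrite hornerZ hB.
have e1 : (1 + z) ^+ j.*2 * (z^*) ^+ j = ((4 * node z) ^+ j)%:C%C.
  rewrite -mul2n exprM -exprMn rmorphXn /= nodeE; congr (_ ^+ j).
  transitivity (z^* + 2 * (z * z^*) + z * (z * z^*)); [ring | rewrite zz; ring].
have -> : (z^*) ^+ n = (z^*) ^+ (n - j) * (z^*) ^+ j by rewrite -exprD subnK.
transitivity ((h`_j / 4 ^+ j)%:C%C * (z * z^*) ^+ (n - j) * ((1 + z) ^+ j.*2 * (z^*) ^+ j)).
  by rewrite exprMn; ring.
rewrite zz expr1n mulr1 e1 -rmorphM /=; congr (_%:C)%C.
rewrite exprMn; field.
by rewrite expf_neq0.
Qed.

Lemma trig_polyP (n : nat) (l : R -> C) : trig_poly n l <->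
  exists2 D : {poly C}, (size D <= n.*2.+1)%N &
    forall x, l x = D.[ecirc x] * ((ecirc x)^*) ^+ n.
Proof.
have e k x : ecirc ((k%:R - n%:R) * x) = ecirc x ^+ k * ((ecirc x)^*) ^+ n.
  by rewrite mulrBl ecircD ecircX -ecirc_conj ecircX rmorphXn.
split=> [[a ha]|[D sD hD]].
  exists (\poly_(k < n.*2.+1) a (inord k)); first exact: size_poly.
  move=> x; rewrite ha horner_poly mulr_suml; apply: eq_bigr => k _.
  by rewrite e mulrA inord_val.
exists (fun k => D`_k) => x; rewrite hD (horner_coef_wide _ sD) mulr_suml.
by apply: eq_bigr => k _; rewrite e mulrA.
Qed.

Lemma cintegral_trig (mu : probability (measurableTypeR R) R) (n : nat) (D : {poly C}) (l : R -> C) :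
  (forall x, l x = D.[ecirc x] * ((ecirc x)^*) ^+ n) -> cintegral mu l = ip mu D 'X^n.
Proof.
by move=> h; congr cintegral; apply/funext => x; rewrite h hornerXn rmorphXn.
Qed.

End Circle.

(** * Uniqueness of touching one-sided approximations *)

Section TrigDerivative.
Variable R : realType.
Local Notation C := R[i].

(** The trigonometric polynomial of the coefficient polynomial [D], and its
    derivative in [x]. *)
Definition trig (n : nat) (D : {poly C}) (x : R) : C := D.[ecirc x] * ((ecirc x)^*) ^+ n.
Definition dtrig (n : nat) (D : {poly C}) (x : R) : C :=
  (2 * pi)%:C%C * 'i%C * (ecirc x * D^`().[ecirc x] - n%:R * D.[ecirc x]) * ((ecirc x)^*) ^+ n.

Lemma is_derive_cos_mul (a x : R) : is_derive x (1 : R) (fun x => cos (a * x)) (- (a * sin (a * x))).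
Proof. by apply: is_derive_eq; rewrite /GRing.scale/=; ring. Qed.

Lemma is_derive_sin_mul (a x : R) : is_derive x (1 : R) (fun x => sin (a * x)) (a * cos (a * x)).
Proof. by apply: is_derive_eq; rewrite /GRing.scale/=; ring. Qed.

(** The complex function [f] of a real variable has derivative [v] at [x]. *)
Definition cis_derive (x : R) (f : R -> C) (v : C) :=
  is_derive x (1 : R) (fun x => Re (f x)) (Re v) /\ is_derive x (1 : R) (fun x => Im (f x)) (Im v).

Lemma cis_deriveM x (f g : R -> C) (v w : C) : cis_derive x f v -> cis_derive x g w ->
  cis_derive x (fun x => f x * g x) (v * g x + f x * w).
Proof.
move=> [f1 f2] [g1 g2]; split.
  under eq_fun do rewrite cReM; rewrite cReD !cReM.
  by apply: is_derive_eq; rewrite /GRing.scale/=; ring.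
under eq_fun do rewrite cImM; rewrite cImD !cImM.
by apply: is_derive_eq; rewrite /GRing.scale/=; ring.
Qed.

Lemma cis_derive_ecirc (x : R) : cis_derive x (@ecirc R) ((2 * pi)%:C%C * 'i%C * ecirc x).
Proof.
split; rewrite /ecirc ?cReM ?cImM /=.
  by have h := is_derive_cos_mul (2 * pi) x; apply: is_derive_eq; rewrite /GRing.scale/=; ring.
by have h := is_derive_sin_mul (2 * pi) x; apply: is_derive_eq; rewrite /GRing.scale/=; ring.
Qed.

Lemma cis_derive_horner (D : {poly C}) (x : R) :
  cis_derive x (fun x => D.[ecirc x]) ((2 * pi)%:C%C * 'i%C * (ecirc x * D^`().[ecirc x])).
Proof.
elim/poly_ind: D => [|D c ih].
  rewrite deriv0 horner0 !mulr0; under eq_fun do rewrite horner0.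
  by split; exact: is_derive_cst.
have h := cis_deriveM ih (cis_derive_ecirc x).
have e : (fun x : R => (D * 'X + c%:P).[ecirc x]) = (fun x => D.[ecirc x] * ecirc x + c).
  by apply/funext => y; rewrite !hornerE.
rewrite e derivD derivC addr0 derivM derivX mulr1 hornerD hornerM hornerX.
set v := (X in cis_derive _ _ X).
have -> : v = (2 * pi)%:C%C * 'i%C * (ecirc x * D^`().[ecirc x]) * ecirc x
   + D.[ecirc x] * ((2 * pi)%:C%C * 'i%C * ecirc x) + 0 by rewrite /v; ring.
case: h => h1 h2; split; rewrite cReD || rewrite cImD.
  by under eq_fun do rewrite cReD; exact: is_deriveD.
by under eq_fun do rewrite cImD; exact: is_deriveD.
Qed.

Lemma cis_derive_trig n (D : {poly C}) (x : R) : cis_derive x (trig n D) (dtrig n D x).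
Proof.
have hE : cis_derive x (fun x => ((ecirc x)^*) ^+ n)
   (- ((2 * pi)%:C%C * 'i%C) * n%:R * ((ecirc x)^*) ^+ n).
  have e y : ((ecirc y)^*) ^+ n = (('X^n : {poly C}).[ecirc y])^* by rewrite hornerXn rmorphXn.
  have [h1 h2] := cis_derive_horner 'X^n x.
  have ev : - ((2 * pi)%:C%C * 'i%C) * n%:R * ((ecirc x)^*) ^+ n =
    ((2 * pi)%:C%C * 'i%C * (ecirc x * ('X^n)^`().[ecirc x]))^*.
    rewrite derivXn hornerMn hornerXn.
    have -> : ecirc x * (ecirc x ^+ n.-1 *+ n) = n%:R * ecirc x ^+ n.
      by case: (n) => [|k]; rewrite ?mulr0n ?mulr0 ?mul0r//= mulrnAr -exprS mulr_natl.
    have aJ : ((2 * pi)%:C%C * 'i%C : C)^* = - ((2 * pi)%:C%C * 'i%C).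
      by apply: complex_eqP; rewrite ?cReJ ?cImJ /=; ring.
    move: ((2 * pi)%:C%C * 'i%C : C) aJ => a aJ.
    by rewrite 2!rmorphM /= rmorph_nat rmorphXn /= aJ mulrA.
  split; rewrite ev ?cReJ ?cImJ.
    by under eq_fun do rewrite e cReJ.
  by under eq_fun do rewrite e cImJ; exact: is_deriveN.
have := cis_deriveM (cis_derive_horner D x) hE.
by congr cis_derive; rewrite /dtrig; ring.
Qed.

End TrigDerivative.

Section Uniqueness.
Variable R : realType.
Local Notation C := R[i].

Lemma derive_eq_at_touch (F G : R -> R) (vF vG c : R) : 0 < c < 1 ->
  (forall x : R, derivable F x 1) -> (forall x : R, derivable G x 1) ->
  is_derive c (1 : R) F vF -> is_derive c (1 : R) G vG ->
  (forall x, 0 < x < 1 -> 0 <= F x - G x) -> F c = G c -> vF = vG.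
Proof.
move=> hc dF dG hF hG ge0 e.
have h : is_derive c (1 : R) (fun x => F x - G x) 0.
  apply: (@derive1_at_min R (fun x => F x - G x) 0 1 c) => //.
  - by move=> x _; apply: derivableB.
  - by move=> x; rewrite in_itv/= e subrr => hx; exact: ge0.
have h2 : is_derive c (1 : R) (fun x => F x - G x) (vF - vG) by exact: is_deriveB.
have := @derive_val _ _ _ _ _ _ _ h; rewrite (@derive_val _ _ _ _ _ _ _ h2).
by move/eqP; rewrite subr_eq0 => /eqP.
Qed.

(** The smooth function with which [flambda] agrees on [0 <= x < 1], where the floor
    vanishes. *)
Definition flambda_core (lambda x : R) : R := cosh (lambda * (x - 2^-1)) / sinh (lambda / 2).

Lemma flambda_coreE lambda x : 0 <= x < 1 -> flambda lambda x = flambda_core lambda x.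
Proof.
move=> hx; rewrite /flambda /flambda_core.
have -> : Num.floor x = 0 by apply/floor_def; rewrite add0r.
by rewrite subr0.
Qed.

Lemma derivable_flambda_core lambda (x : R) : derivable (flambda_core lambda) x 1.
Proof.
rewrite /flambda_core /cosh; exact: ex_derive.
Qed.

Variables (lambda t : R) (n : nat).
Hypothesis t_sign : t = 1 \/ t = -1.

(** The function [l] is real-valued, and below [flambda] for [t = 1], above it for
    [t = -1]: in the order of [C], [0 <= z] says that [z] is real and nonnegative. *)
Definition one_sided (l : R -> C) :=
  forall x, 0 <= t%:C%C * ((flambda lambda x)%:C%C - l x).

Lemma t_neq0 : t != 0.
Proof. by case: t_sign => ->; rewrite ?oppr_eq0 oner_eq0. Qed.

Lemma one_sidedP l : one_sided l <->
  forall x, Im (l x) = 0 /\ 0 <= t * (flambda lambda x - Re (l x)).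
Proof.
split=> h x; have := h x; rewrite lecE cReM cImM /=; case: (l x) => a b /=.
  move=> /andP[/eqP h1 h2]; split; last by move: h2; rewrite mul0r subr0.
  move: h1; rewrite mul0r addr0 sub0r mulrN => /eqP.
  by rewrite oppr_eq0 mulf_eq0 (negbTE t_neq0) => /eqP.
by move=> [-> h2]; rewrite subrr mulr0 !mul0r addr0 eqxx subr0.
Qed.

(** [t (flambda - l)] is nonnegative and vanishes at the touching point, a minimum;
    hence the derivatives of [flambda] and [l] agree there. *)
Lemma one_sided_deriv (D : {poly C}) (x : R) : 0 < x < 1 ->
  one_sided (trig n D) -> trig n D x = (flambda lambda x)%:C%C ->
  Im (dtrig n D x) = 0 /\
  is_derive x (1 : R) (flambda_core lambda) (Re (dtrig n D x)).
Proof.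
move=> hx /one_sidedP oD e.
have [h1 h2] := cis_derive_trig n D x.
have hx' : 0 <= x < 1 by case/andP: hx => /ltW -> ->.
split.
  have h3 : is_derive x (1 : R) (fun x => Im (trig n D x)) 0.
    by under eq_fun do rewrite (oD _).1; exact: is_derive_cst.
  by rewrite -(@derive_val _ _ _ _ _ _ _ h2) (@derive_val _ _ _ _ _ _ _ h3).
have dF' (y : R) : derivable (flambda_core lambda) y 1 by exact: derivable_flambda_core.
have hF : is_derive x (1 : R) (flambda_core lambda) ('D_1 (flambda_core lambda) x).
  exact: derivableP.
have dG (y : R) : derivable (fun x => Re (trig n D x)) y 1.
  by have [h _] := cis_derive_trig n D y; exact: ex_derive.
have ec : flambda_core lambda x = Re (trig n D x) by rewrite e -flambda_coreE.
have ge y : 0 < y < 1 -> 0 <= t * (flambda_core lambda y - Re (trig n D y)).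
  move=> hy; rewrite -flambda_coreE; first exact: (oD y).2.
  by case/andP: hy => /ltW -> ->.
suff -> : Re (dtrig n D x) = 'D_1 (flambda_core lambda) x by [].
case: t_sign => te; rewrite te in ge.
  apply/esym; apply: (derive_eq_at_touch hx dF' dG hF h1) => // y /ge; by rewrite mul1r.
apply: (derive_eq_at_touch hx dG dF' h1 hF) => // y /ge; by rewrite mulN1r opprB.
Qed.

Lemma touching_deriv (D1 D2 : {poly C}) (x : R) : 0 < x < 1 ->
  one_sided (trig n D1) -> one_sided (trig n D2) ->
  trig n D1 x = (flambda lambda x)%:C%C -> trig n D2 x = (flambda lambda x)%:C%C ->
  root (D1 - D2)^`() (ecirc x).
Proof.
move=> hx o1 o2 e1 e2.
have [i1 r1] := one_sided_deriv hx o1 e1; have [i2 r2] := one_sided_deriv hx o2 e2.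
have e : dtrig n D1 x = dtrig n D2 x.
  apply: complex_eqP; last by rewrite i1 i2.
  by rewrite -(@derive_val _ _ _ _ _ _ _ r1) (@derive_val _ _ _ _ _ _ _ r2).
have en0 : ((ecirc x)^*) ^+ n != 0 :> C by rewrite expf_neq0// conjC_eq0 ecirc_neq0.
have eD : D1.[ecirc x] = D2.[ecirc x].
  by move: e1; rewrite -e2 /trig => /(mulIf en0).
have a0 : (2 * pi)%:C%C * 'i%C != 0 :> C.
  apply: mulf_neq0; last by rewrite eq_complex /= oner_eq0 andbF.
  by rewrite eq_complex /= eqxx andbT mulf_neq0// gt_eqF// pi_gt0.
move: e; rewrite /dtrig eD => /(mulIf en0) /(mulfI a0) /addIr /(mulfI (ecirc_neq0 x)) e.
by rewrite rootE derivB hornerD hornerN e subrr.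
Qed.

(** The difference of the coefficient polynomials has degree at most [2n] and vanishes
    to second order at the [n+1] points of [r], except possibly at 1, where it
    vanishes to first order. *)
Lemma touching_unique (r : seq C) (D1 D2 : {poly C}) :
  uniq r -> size r = n.+1 -> (forall z, z \in r -> z * z^* = 1) ->
  (size D1 <= n.*2.+1)%N -> (size D2 <= n.*2.+1)%N ->
  one_sided (trig n D1) -> one_sided (trig n D2) ->
  {in r, forall z, trig n D1 (circ_arg z) = (flambda lambda (circ_arg z))%:C%C} ->
  {in r, forall z, trig n D2 (circ_arg z) = (flambda lambda (circ_arg z))%:C%C} ->
  D1 = D2.
Proof.
move=> ur sr hr s1 s2 o1 o2 e1 e2.
set D := D1 - D2.
have sD : (size D <= n.*2.+1)%N.
  by rewrite (leq_trans (size_polyD _ _))// geq_max size_polyN s1.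
have rD z : z \in r -> root D z.
  move=> zr; have := e1 z zr; rewrite -(e2 z zr) /trig circ_argK ?hr// => /mulIf h.
  rewrite rootE hornerD hornerN h ?subrr// expf_neq0//.
  by apply/eqP => z0; have /eqP := hr z zr; rewrite z0 mulr0 eq_sym oner_eq0.
pose P : {poly C} := \prod_(z <- r) ('X - z%:P).
have /dvdpP [Q hQ] : P %| D.
  by apply: uniq_roots_dvdp; [apply/allP => z; exact: rD | rewrite uniq_rootsE].
have sP : size P = n.+2 by rewrite size_prod_XsubC sr.
have P0 : P != 0 by rewrite -size_poly_gt0 sP.
have sQ : (size Q <= n)%N.
  have [->|Q0] := eqVneq Q 0; first by rewrite size_poly0.
  by move: sD; rewrite hQ size_mul// sP !addnS /= ltnS -addnn leq_add2r.
suff Q0 : Q = 0 by apply/eqP; rewrite -subr_eq0 -/D hQ Q0 mul0r.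
have rQ z : z \in r -> z != 1 -> root Q z.
  move=> zr z1; have [/andP[x0 x1] ex] := circ_argP (hr z zr).
  have xp : 0 < circ_arg z < 1.
    rewrite x1 andbT lt_def x0 andbT; apply: contraNneq z1 => e.
    by rewrite -ex e ecirc0.
  have := touching_deriv xp o1 o2 (e1 z zr) (e2 z zr); rewrite -/D ex hQ derivM.
  rewrite rootE hornerD !hornerM.
  have /eqP -> : P.[z] == 0 by rewrite -rootE root_prod_XsubC.
  rewrite mulr0 add0r mulf_eq0 => /orP[//|/eqP dP].
  exfalso; have zR : z \notin rem z r by rewrite mem_rem_uniqF.
  move: dP; rewrite /P (perm_big _ (perm_to_rem zr)) /= big_cons derivM derivXsubC mul1r.
  rewrite hornerD hornerM hornerXsubC subrr mul0r addr0 => /eqP.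
  by rewrite -rootE root_prod_XsubC (negbTE zR).
apply/eqP; apply: contraT => Q0.
have := @max_poly_roots _ Q (rem 1 r) Q0 _ (rem_uniq _ ur).
have -> : all (root Q) (rem 1 r).
  by apply/allP => z; rewrite mem_rem_uniq// !inE => /andP[z1 zr]; exact: rQ.
move=> /(_ isT) h; have := leq_trans h sQ; rewrite ltnNge => /negP []; have := sr.
case: (boolP (1 \in r)) => h1; first by rewrite size_rem// => ->.
by rewrite rem_id// => ->.
Qed.

End Uniqueness.

(** * The extremal problem *)

Section Extremal.
Variables (R : realType) (mu : probability (measurableTypeR R) R).
Hypothesis nt : nontrivial_measure mu.
Hypothesis ev : even_measure mu.
Variables (lambda t : R) (n : nat).
Hypothesis lambda_gt0 : 0 < lambda.
Hypothesis t_sign : t = 1 \/ t = -1.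
Local Notation C := R[i].
Local Notation p := (phi mu n.+1).
Local Notation Y := (paraorth p t%:C%C).
Local Notation flambda := (flambda lambda).

Let sp : size p = n.+2. Proof. exact: size_phi. Qed.
Let po j : (j <= n)%N -> ip mu p 'X^j = 0. Proof. by move=> hj; exact: phi_orth. Qed.
Let pl : p`_n.+1 * ip mu p 'X^(n.+1) = 1. Proof. exact: phi_lead. Qed.
Let pr : map_poly Num.conj p = p. Proof. exact: phi_real. Qed.
Let t2 : t * t = 1. Proof. by case: t_sign => ->; rewrite ?mulr1 ?mulrNN ?mulr1. Qed.
Let tau2 : t%:C%C * t%:C%C = 1 :> C. Proof. by rewrite -rmorphM /= t2. Qed.
Let tauJ : (t%:C%C : C)^* = t%:C%C. Proof. by apply: complex_eqP; rewrite ?cReJ ?cImJ //= oppr0. Qed.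

Let root_circle z : root Y z -> z * z^* = 1.
Proof. exact: (paraorth_root_circle nt sp po pl pr tau2 tauJ). Qed.

Variable r : seq C.
Hypothesis ur : uniq r.
Hypothesis sr : size r = n.+1.
Hypothesis Yr : Y = Y`_n.+1 *: \prod_(z <- r) ('X - z%:P).
Hypothesis rr : r =i root Y.

Let r_root z : z \in r -> root Y z. Proof. by rewrite rr. Qed.
Let r_circle z : z \in r -> z * z^* = 1. Proof. by move=> /r_root; exact: root_circle. Qed.

(** Monic polynomial with the zeros of [Y], in the coordinate [node]. *)
Definition node_poly : {poly R} := \prod_(a <- map (@node R) r) ('X - a%:P).
Local Notation W := node_poly.

(** [Y] has real coefficients, so its zeros are invariant under conjugation and, for
    [w] on the circle, [prod 4 w (node w - node z) = prod (w - z) (w - conj z)] is a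
    positive multiple of [Y(w)^2 = t w^(n+1) |Y(w)|^2]. *)
Lemma node_poly_sign : exists2 a : R, 0 < a &
  forall x, t * W.[node (ecirc x)] = a * sqnorm Y x.
Proof.
have YJ := paraorthJ sp pr tauJ.
have Yk := Yr; set k := Y`_n.+1 in Yk.
have k0 : k != 0 by exact: (paraorth_lead_neq0 nt sp po pl pr tau2).
have kJ : k^* = k by rewrite /k -[in RHS]YJ coef_map.
have kE : k = (Re k)%:C%C.
  by apply: complex_eqP => //=; have := congr1 (@Im R) kJ; rewrite cImJ; lra.
have K0 : 0 < (Re k) ^+ 2 * 4 ^+ n.+1.
  apply: mulr_gt0; last by rewrite exprn_gt0.
  rewrite lt_def sqr_ge0 andbT sqrf_eq0.
  by apply: contra k0 => /eqP h; rewrite kE h.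
exists ((Re k) ^+ 2 * 4 ^+ n.+1)^-1; first by rewrite invr_gt0.
move=> x; set e := ecirc x.
have e0 : e != 0 by exact: ecirc_neq0.
have ee : e * e^* = 1 by exact: ecirc_mulJ.
have Y1 : Y.[e] = k * \prod_(z <- r) (e - z).
  rewrite {1}Yk hornerZ horner_prod; congr (_ * _).
  by apply: eq_bigr => z _; rewrite hornerXsubC.
have Y2 : Y.[e] = k * \prod_(z <- r) (e - z^*).
  rewrite -{1}YJ -[e]conjCK horner_map /= {1}Yk hornerZ horner_prod rmorphM /= kJ.
  rewrite rmorph_prod /=; congr (_ * _).
  by apply: eq_bigr => z _; rewrite hornerXsubC rmorphB /= conjCK.
have Y3 : t%:C%C * Y.[e] = e ^+ n.+1 * (Y.[e])^*.
  rewrite -hornerZ -(recip_paraorth nt sp po pl pr tau2 tauJ) recip_horner//.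
  by rewrite (size_paraorth nt sp po pl pr tau2) /= -ecircV invrK.
have P4 : (\prod_(z <- r) (e - z)) * (\prod_(z <- r) (e - z^*)) =
    e ^+ n.+1 * (4 ^+ n.+1 * W.[node e])%:C%C.
  rewrite -big_split /= /node_poly horner_prod big_map rmorphM /= rmorph_prod /=.
  have cst (w : C) : w ^+ n.+1 = \prod_(z <- r) w.
    by rewrite big_const_seq count_predT sr iter_mulr_1.
  rewrite rmorphXn /= !cst -!big_split /=; apply: eq_big_seq => z zr.
  have -> : (4 : R)%:C%C * ('X - (node z)%:P).[node e]%:C%C = (2 + e + e^*) - (2 + z + z^*).
    by rewrite hornerXsubC -!nodeE -rmorphM -rmorphB /= mulrBr.
  have zz := r_circle zr.
  transitivity (e * e - e * z - e * z^* + z * z^*); first ring.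
  transitivity (e * e - e * z - e * z^* + e * e^*); last ring.
  by rewrite zz ee.
have main : e ^+ n.+1 * (k * k * (4 ^+ n.+1 * W.[node e])%:C%C * t%:C%C) =
   e ^+ n.+1 * (sqnorm Y x)%:C%C.
  rewrite sqnormE -/e.
  transitivity (k * k * t%:C%C * ((\prod_(z <- r) (e - z)) * (\prod_(z <- r) (e - z^*)))).
    by rewrite P4; ring.
  transitivity (t%:C%C * Y.[e] * Y.[e]); last by rewrite Y3; ring.
  by rewrite {1}Y1 Y2; ring.
have en0 : e ^+ n.+1 != 0 by rewrite expf_neq0.
move: main => /(mulfI en0); rewrite kE -!rmorphM /= => /complexI h.
by apply: (mulfI (x := (Re k) ^+ 2 * 4 ^+ n.+1)); rewrite ?gt_eqF// mulVKf ?gt_eqF// -h; ring.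
Qed.

Lemma node_poly_ge0 x : 0 <= t * W.[node (ecirc x)].
Proof.
have [a a0 ha] := node_poly_sign.
by rewrite ha mulr_ge0 ?sqnorm_ge0// ltW.
Qed.

(** Quadrature weights as real numbers. *)
Definition real_weight (z : C) : R := Re (quad_weight mu n p t%:C%C z).

Lemma real_weight_gt0 z : z \in r -> 0 < real_weight z.
Proof.
by move=> /r_root /(quad_weight_gt0 nt sp po pl pr tau2 tauJ); rewrite ltcE => /andP[_].
Qed.

Lemma real_weightE z : z \in r -> quad_weight mu n p t%:C%C z = (real_weight z)%:C%C.
Proof.
move=> /r_root /(quad_weight_gt0 nt sp po pl pr tau2 tauJ) h.
by apply: complex_eqP => //=; exact: ger0_Im (ltW h).
Qed.

Lemma quadrature_trig (D : {poly C}) : (size D <= n.*2.+1)%N ->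
  cintegral mu (trig n D) = \sum_(z <- r) (real_weight z)%:C%C * trig n D (circ_arg z).
Proof.
move=> sD; rewrite (@cintegral_trig R mu n D)//.
rewrite (quadrature nt sp po pl pr tau2 tauJ ur sr rr sD).
by apply: eq_big_seq => z zr; rewrite real_weightE// /trig circ_argK ?r_circle.
Qed.

Lemma bcont_node_poly (h : {poly R}) : bounded_continuous (fun x : R => h.[node (ecirc x)]).
Proof.
elim/poly_ind: h => [|h c ih]; first by under eq_fun do rewrite horner0; exact: bcont_cst.
have -> : (fun x : R => (h * 'X + c%:P).[node (ecirc x)]) =
    (fun x => h.[node (ecirc x)] * ((1 + cos (2 * pi * x)) * 2^-1) + c).
  by apply/funext => y; rewrite !hornerE.
apply: bcontD; last exact: bcont_cst.
apply: bcontM => //; apply: bcontM; last exact: bcont_cst.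
by apply: bcontD; [exact: bcont_cst | exact: bcont_cos].
Qed.

Lemma quadrature_node (h : {poly R}) : (size h <= n.+1)%N ->
  \int[mu]_x h.[node (ecirc x)] = \sum_(z <- r) real_weight z * h.[node z].
Proof.
move=> sh; have [D sD hD] := node_poly_lift sh.
have e : trig n D = fun x => (h.[node (ecirc x)])%:C%C.
  by apply/funext => x; rewrite /trig hD ?ecirc_mulJ.
have := quadrature_trig sD; rewrite e => /(congr1 (@Re R)) /= ->.
transitivity (Re (\sum_(z <- r) real_weight z * h.[node z])%:C%C) => //.
congr Re; rewrite rmorph_sum /=; apply: eq_big_seq => z zr.
by rewrite rmorphM /= circ_argK ?r_circle.
Qed.

Lemma sqnormM (P Q : {poly C}) x : sqnorm (P * Q) x = sqnorm P x * sqnorm Q x.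
Proof.
by apply: complexI; rewrite rmorphM /= !sqnormE hornerM rmorphM /=; ring.
Qed.

Lemma sqnorm_1DX (x : R) : sqnorm (1 + 'X) x = 4 * node (ecirc x).
Proof.
apply: complexI; rewrite sqnormE nodeE hornerD hornerX -polyC1 hornerC rmorphD rmorph1 /=.
by have := ecirc_mulJ x; move: (ecirc x) => e ee; transitivity (1 + e + e^* + e * e^*);
  [ring | rewrite ee; ring].
Qed.

Lemma sqnormX_1DX (x : R) j : sqnorm ((1 + 'X) ^+ j) x = (4 * node (ecirc x)) ^+ j.
Proof.
elim: j => [|j ih]; last by rewrite exprS sqnormM sqnorm_1DX ih exprS.
by apply: complexI; rewrite sqnormE -polyC1 hornerC rmorph1 mulr1.
Qed.

(** [t W(u) u^j] is a positive multiple of [|Y (1 + X)^j|^2], so its integral is positive;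
    it bounds the coefficients of the quotients in [extremal_exists]. *)
Let nodepow_integrand j (x : R) : R := t * W.[node (ecirc x)] * node (ecirc x) ^+ j.

Let nodepow_bcont j : bounded_continuous (nodepow_integrand j).
Proof.
have -> : nodepow_integrand j = fun x => t * (W * 'X^j).[node (ecirc x)].
  by apply/funext => x; rewrite /nodepow_integrand hornerM hornerXn mulrA.
by apply: bcontM; [exact: bcont_cst | exact: bcont_node_poly].
Qed.

Let nodepow_int_gt0 j : 0 < \int[mu]_x nodepow_integrand j x.
Proof.
have [a a0 ha] := node_poly_sign.
have -> : \int[mu]_x nodepow_integrand j x =
    \int[mu]_x (a / 4 ^+ j * sqnorm (Y * (1 + 'X) ^+ j) x).
  apply: eq_Rintegral => x _; rewrite /nodepow_integrand ha sqnormM sqnormX_1DX.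
  rewrite (exprMn _ 4); move: (node _ ^+ j) => v.
  by field; rewrite expf_neq0.
rewrite RintegralZl//; last exact/bcont_integrable/bcont_sqnorm.
apply: mulr_gt0; first by rewrite divr_gt0// exprn_gt0.
have h : 0 < ip mu (Y * (1 + 'X) ^+ j) (Y * (1 + 'X) ^+ j).
  apply: (ip_gt0 nt); rewrite mulf_neq0 ?(paraorth_neq0 nt sp po pl pr tau2)// expf_neq0//.
  by rewrite addrC -(opprK 1) -polyCN polyXsubC_eq0.
by move: h; rewrite ip_sqnorm ltcR.
Qed.

Lemma node_le1 (x : R) : 0 <= node (ecirc x) <= 1.
Proof. exact: node_bound (ecirc_mulJ x). Qed.

Lemma extremal_exists : exists D : {poly C}, [/\ (size D <= n.*2.+1)%N,
  one_sided lambda t (trig n D) &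
  {in r, forall z, trig n D (circ_arg z) = (flambda (circ_arg z))%:C%C}].
Proof.
have [c c0 hc] := flambda_series lambda_gt0.
pose PN N : {poly R} := \poly_(k < N) c k.
have s_ge0 : {in map (@node R) r, forall a, 0 <= a}.
  by move=> a /mapP[z zr ->]; case/andP: (node_bound (r_circle zr)).
have cvP x : (fun N => (PN N).[node (ecirc x)]) @ \oo --> flambda x.
  by under eq_fun do rewrite horner_poly; exact: hc x.
have P_ge0 N v : 0 <= v -> 0 <= (PN N).[v].
  by move=> v0; rewrite horner_poly sumr_ge0// => i _; rewrite mulr_ge0// exprn_ge0.
have P_nd v : 0 <= v -> {homo (fun N => (PN N).[v]) : m k / (m <= k)%N >-> m <= k}.
  move=> v0; apply/nondecreasing_seqP => N.
  by rewrite !horner_poly big_ord_recr /= lerDl mulr_ge0// exprn_ge0.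
have leP N x : (PN N).[node (ecirc x)] <= flambda x.
  have /andP[v0 _] := node_le1 x.
  have cv : cvgn (fun N => (PN N).[node (ecirc x)]) by apply/cvg_ex; exists (flambda x).
  rewrite -(cvg_lim (@norm_hausdorff _ _) (cvP x)).
  exact: nondecreasing_cvgn_le (P_nd _ v0) cv N.
pose M := flambda 0.
have leM N x : (PN N).[node (ecirc x)] <= M.
  apply: le_trans (leP N 0).
  have -> : node (ecirc 0) = 1 :> R by rewrite ecirc0 /node /=; lra.
  have /andP[v0 v1] := node_le1 x.
  rewrite !horner_poly; apply: ler_sum => i _.
  by rewrite ler_wpM2l// lerXn2r// nnegrE.
have W0 : W != 0 by rewrite monic_neq0// monic_prod_XsubC.
have sW : size W = n.+2 by rewrite size_prod_XsubC size_map sr.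
have sH N : (size (PN N %% W)%R <= n.+1)%N by rewrite -ltnS -sW ltn_modp.
have HP N z : z \in r -> (PN N %% W).[node z] = (PN N).[node z].
  by move=> zr; apply: horner_mod; rewrite root_prod_XsubC map_f.
have PH N v : (PN N).[v] - (PN N %% W).[v] = (PN N %/ W).[v] * W.[v].
  by rewrite {1}(divp_eq (PN N) W) hornerD hornerM addrK.
have G_ge0 N i : 0 <= (PN N %/ W)`_i by exact: series_quotient_ge0.
have Gj N j v : 0 <= v -> (PN N %/ W)`_j * v ^+ j <= (PN N %/ W).[v].
  move=> v0; rewrite horner_coef; case: (ltnP j (size (PN N %/ W)%R)) => hj.
    rewrite (bigD1 (Ordinal hj)) //= lerDl sumr_ge0// => i _.
    by rewrite mulr_ge0// exprn_ge0.
  rewrite nth_default// mul0r sumr_ge0// => i _.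
  by rewrite mulr_ge0// exprn_ge0.
pose B := M + \sum_(z <- r) real_weight z * M.
(* If [G = PN %/ W], then [G_j t W u^j <= t W G = t (PN - PN %% W)]; the integral of
   [PN %% W] is given by the quadrature and only involves values of [PN]. *)
have bnd j : exists M', forall N, (PN N %/ W)`_j <= M'.
  exists (B / \int[mu]_x nodepow_integrand j x) => N.
  rewrite ler_pdivlMr// -RintegralZl//; last exact/bcont_integrable/nodepow_bcont.
  have iP := bcont_node_poly (PN N); have iH := bcont_node_poly (PN N %% W).
  have bD : bounded_continuous (fun x : R => t * ((PN N).[node (ecirc x)] - (PN N %% W).[node (ecirc x)])).
    by apply: bcontM; [exact: bcont_cst | apply: bcontD => //; exact: bcontN].
  apply: (@le_trans _ _ (\int[mu]_x (t * ((PN N).[node (ecirc x)] - (PN N %% W).[node (ecirc x)])))).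
    apply: le_Rintegral => //; try apply: bcont_integrable => //.
      by apply: bcontM; [exact: bcont_cst | exact: nodepow_bcont].
    move=> x _; rewrite PH /nodepow_integrand; have /andP[v0 v1] := node_le1 x.
    rewrite mulrCA (_ : t * (_ * W.[node (ecirc x)]) =
      t * W.[node (ecirc x)] * (PN N %/ W).[node (ecirc x)]); last by rewrite mulrA mulrAC.
    by rewrite ler_wpM2l ?node_poly_ge0// Gj.
  rewrite RintegralZl//; last by apply: bcont_integrable; apply: bcontD => //; exact: bcontN.
  rewrite RintegralB//; try exact: bcont_integrable.
  rewrite (quadrature_node (sH N)).
  have h1 : 0 <= \int[mu]_x (PN N).[node (ecirc x)] <= M.
    apply/andP; split.
      by apply: Rintegral_ge0 => x _; apply: P_ge0; case/andP: (node_le1 x).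
    have -> : M = \int[mu]_x (cst M x).
      have pT : mu setT = 1%E by exact: probability_setT.
      by rewrite Rintegral_cst// -[X in _ * X]/(fine (mu setT)) pT mulr1.
    apply: le_Rintegral => //; try apply: bcont_integrable => //.
    exact: bcont_cst.
  have h2 : 0 <= \sum_(z <- r) real_weight z * (PN N %% W).[node z] <=
      \sum_(z <- r) real_weight z * M.
    apply/andP; split.
      rewrite big_seq; apply: sumr_ge0 => z zr; rewrite mulr_ge0 ?(ltW (real_weight_gt0 zr))// HP// P_ge0//.
      by case/andP: (node_bound (r_circle zr)).
    rewrite [leLHS]big_seq [leRHS]big_seq; apply: ler_sum => z zr; rewrite ler_wpM2l ?(ltW (real_weight_gt0 zr))// HP//.
    by rewrite -(circ_argK (r_circle zr)).
  rewrite /B; move: h1 h2 => /andP[h1 h1'] /andP[h2 h2'].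
  by case: t_sign => ->; lra.
have [h sh hh] := interpolant_cvg c0 s_ge0 bnd.
rewrite size_map sr in sh.
have [D sD hD] := node_poly_lift sh.
have tD x : trig n D x = (h.[node (ecirc x)])%:C%C by rewrite /trig hD// ecirc_mulJ.
exists D; split => //.
  apply/one_sidedP => // x; rewrite tD /=; split=> //.
  have /andP[v0 v1] := node_le1 x.
  have cv : (fun N => t * ((PN N).[node (ecirc x)] - (PN N %% W).[node (ecirc x)])) @ \oo -->
      t * (flambda x - h.[node (ecirc x)]).
    by apply: cvgMr; apply: cvgB; [exact: cvP | exact: hh].
  apply: (cvgr_to_ge cv); near=> N; rewrite PH mulrCA mulr_ge0 ?node_poly_ge0//.
  by rewrite horner_coef sumr_ge0// => i _; rewrite mulr_ge0// exprn_ge0.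
move=> z zr; rewrite tD circ_argK ?r_circle//; congr (_%:C)%C.
have h1 := cvP (circ_arg z); rewrite circ_argK ?r_circle// in h1.
have h2 := hh (node z).
have e : (fun N => (PN N %% W).[node z]) = (fun N => (PN N).[node z]).
  by apply/funext => N; rewrite HP.
rewrite e in h2.
exact: (cvg_unique (@norm_hausdorff _ _) h2 h1).
Unshelve. all: by end_near. Qed.

(** The value of the extremal problem. *)
Definition quad_value : C := \sum_(z <- r) (real_weight z)%:C%C * (flambda (circ_arg z))%:C%C.

Lemma quad_value_circle_zeros (P : {poly C}) (k : C) : k != 0 -> P = k *: Y ->
  \sum_(xi \in circle_zeros P) ((flambda xi)%:C%C / Kn mu n (ecirc xi) (ecirc xi)) = quad_value.
Proof.
move=> k0 hP; rewrite (@sum_circle_zeros R P r)//; last by move=> z; rewrite hP rootZ// rr.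
apply: eq_big_seq => z zr; rewrite circ_argK ?r_circle// mulrC; congr (_ * _).
by rewrite (Kn_root nt ev tau2 tauJ (r_root zr)) real_weightE.
Qed.

(** By the quadrature, the gap in the integral inequality is the weighted sum of the
    gaps at the nodes. *)
Lemma quad_gap (D : {poly C}) : (size D <= n.*2.+1)%N ->
  t%:C%C * (quad_value - cintegral mu (trig n D)) =
  \sum_(z <- r) (real_weight z)%:C%C *
    (t%:C%C * ((flambda (circ_arg z))%:C%C - trig n D (circ_arg z))).
Proof.
move=> sD; rewrite (quadrature_trig sD) /quad_value -sumrB mulr_sumr.
by apply: eq_bigr => z _; ring.
Qed.

Lemma extremal_bound (D : {poly C}) : (size D <= n.*2.+1)%N ->
  one_sided lambda t (trig n D) -> 0 <= t%:C%C * (quad_value - cintegral mu (trig n D)).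
Proof.
move=> sD oD; rewrite quad_gap// big_seq sumr_ge0// => z zr.
by rewrite mulr_ge0// ler0c ltW// real_weight_gt0.
Qed.

Lemma extremal_touch (D : {poly C}) : (size D <= n.*2.+1)%N ->
  one_sided lambda t (trig n D) -> cintegral mu (trig n D) = quad_value ->
  {in r, forall z, trig n D (circ_arg z) = (flambda (circ_arg z))%:C%C}.
Proof.
move=> sD oD e z zr.
have := quad_gap sD; rewrite e subrr mulr0 big_seq => /esym/eqP.
rewrite psumr_eq0 => [|w wr]; last by rewrite mulr_ge0// ler0c ltW// real_weight_gt0.
move=> /allP /(_ z zr) /implyP /(_ zr).
have w0 : (real_weight z)%:C%C != 0 :> C.
  by rewrite eq_complex /= eqxx andbT gt_eqF// real_weight_gt0.
have t0 : t%:C%C != 0 :> C by rewrite eq_complex /= eqxx andbT t_neq0.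
by rewrite !mulf_eq0 (negbTE w0) (negbTE t0) /= subr_eq0 => /eqP.
Qed.

Lemma extremal_problem :
  (forall l, trig_poly n l -> one_sided lambda t l -> 0 <= t%:C%C * (quad_value - cintegral mu l)) /\
  (exists! l, (trig_poly n l /\ one_sided lambda t l) /\ cintegral mu l = quad_value).
Proof.
have tE l D : (forall x, l x = D.[ecirc x] * ((ecirc x)^*) ^+ n) -> l = trig n D.
  by move=> h; apply/funext => x; rewrite h.
split=> [l /trig_polyP [D sD /tE ->]|]; first exact: extremal_bound.
have [D [sD oD eD]] := extremal_exists.
exists (trig n D); split.
  split; first by split=> //; apply/trig_polyP; exists D.
  rewrite (quadrature_trig sD) /quad_value; apply: eq_big_seq => z zr; by rewrite eD.
move=> l [[/trig_polyP [D' sD' /tE ->]] oD' e].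
congr trig; apply: (touching_unique t_sign ur sr r_circle sD sD' oD oD' eD).
exact: extremal_touch.
Qed.

End Extremal.

(* In the order of R[i], [z <= x%:C] means that z is real and at most x. *)
Theorem theorem27 (R : realType) (lambda : R) (lambda_gt0 : 0 < lambda) (n : nat)
    (mu : probability (measurableTypeR R) R)
    (mu_circle : mu `[0%R, 1%R[%classic = 1%E)
    (mu_nontrivial : nontrivial_measure mu) (mu_even : even_measure mu) :
  let quadA : R[i] := \sum_(xi \in circle_zeros (An mu n))
        (flambda lambda xi)%:C%C / Kn mu n (ecirc xi) (ecirc xi) in
  let quadB : R[i] := \sum_(xi \in circle_zeros (Bn mu n))
        (flambda lambda xi)%:C%C / Kn mu n (ecirc xi) (ecirc xi) in
  let minorant (l : R -> R[i]) :=
    trig_poly n l /\ forall theta : R, l theta <= (flambda lambda theta)%:C%C in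
  let majorant (m : R -> R[i]) :=
    trig_poly n m /\ forall theta : R, (flambda lambda theta)%:C%C <= m theta in
  ((forall l, minorant l -> cintegral mu l <= quadA) /\
   (exists! l, minorant l /\ cintegral mu l = quadA)) /\
  ((forall m, majorant m -> quadB <= cintegral mu m) /\
   (exists! m, majorant m /\ cintegral mu m = quadB)).
Proof.
move=> quadA quadB minorant majorant.
have roots (t : R) : t = 1 \/ t = -1 -> exists r : seq R[i], [/\ uniq r, size r = n.+1,
    let Y := paraorth (phi mu n.+1) t%:C%C in Y = Y`_n.+1 *: \prod_(z <- r) ('X - z%:P) &
    r =i root (paraorth (phi mu n.+1) t%:C%C)].
  move=> ht; apply: (paraorth_roots mu_nontrivial) => //.
  - exact: size_phi.
  - by move=> j hj; exact: phi_orth.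
  - exact: phi_lead.
  - exact: phi_real.
  - by rewrite -rmorphM; case: ht => ->; rewrite ?mulr1 ?mulrNN ?mulr1.
  - by apply: complex_eqP; rewrite ?cReJ ?cImJ //= oppr0.
split.
- have h1 : (1 : R) = 1 \/ (1 : R) = -1 by left.
  have [r [ur sr Yr rr]] := roots 1 h1.
  have [ub ex] := extremal_problem mu_nontrivial mu_even lambda_gt0 h1 ur sr Yr rr.
  have mE l : minorant l <-> trig_poly n l /\ one_sided lambda 1 l.
    by split=> -[h h']; split=> // x; have := h' x; rewrite mul1r subr_ge0.
  have qE : quadA = quad_value mu lambda 1 n r.
    apply: (quad_value_circle_zeros mu_nontrivial mu_even lambda h1 ur rr (k := 2^-1)).
      by rewrite invr_eq0 pnatr_eq0.
    by rewrite /An /paraorth scale1r.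
  rewrite qE; split=> [l /mE [h h']|].
    by have := ub l h h'; rewrite mul1r subr_ge0.
  have [l [[h1' h2'] hu]] := ex; exists l; split; first by split=> //; apply/mE.
  by move=> l' [/mE h3 h4]; exact: hu.
- have h1 : (-1 : R) = 1 \/ (-1 : R) = -1 by right.
  have [r [ur sr Yr rr]] := roots (-1) h1.
  have [ub ex] := extremal_problem mu_nontrivial mu_even lambda_gt0 h1 ur sr Yr rr.
  have N1 : (-1)%:C%C = -1 :> R[i] by rewrite rmorphN rmorph1.
  have mE l : majorant l <-> trig_poly n l /\ one_sided lambda (-1) l.
    by split=> -[h h']; split=> // x; have := h' x; rewrite N1 mulN1r opprB subr_ge0.
  have qE : quadB = quad_value mu lambda (-1) n r.
    apply: (quad_value_circle_zeros mu_nontrivial mu_even lambda h1 ur rr (k := 'i%C / 2)).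
      by rewrite mulf_neq0 ?invr_eq0 ?pnatr_eq0// eq_complex /= oner_eq0 andbF.
    by rewrite /Bn /paraorth N1 scaleN1r.
  rewrite qE; split=> [l /mE [h h']|].
    by have := ub l h h'; rewrite N1 mulN1r opprB subr_ge0.
  have [l [[h1' h2'] hu]] := ex; exists l; split; first by split=> //; apply/mE.
  by move=> l' [/mE h3 h4]; exact: hu.
Qed.
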